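(* (i) For every $n\ge2$: $\Gamma(n-1,0)\subset\Gamma(n,0)$, and $0$ is a cluster point of $\Gamma(n,0)$. Furthermore, for every $n\ge3$, $1$ is also a cluster point of $\Gamma(n,0)$. In particular, the set $\Gamma(n,0)$ is infinite for every $n\geq 2$. (ii) For every integer $l\ge1$: $\Gamma(n-1,l)\subset\Gamma(n,l)$ for every $n\ge2$, and $\Gamma(n,l)$ is finite for every $n\ge1$. (iii) For every $n\ge1$, every integer $l\geq 0$ and every $P\in\mathcal{P}_0^n(l)$, $$\frac12\left(\frac{2}{l+1}\right)^{1/n}\le\bigl(\gamma_1(P)\cdots\gamma_n(P)\bigr)^{1/n},$$ and the bound is tight, i.e., for every $n\ge1$ and every odd $l\geq 1$ there is a $P\in\mathcal{P}_0^n(l)$ for which equality holds.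
   Context: A lattice $n$-polytope is a convex polytope $P\subset\mathbb{R}^n$ with $\dim P=n$ all of whose vertices lie in $\mathbb{Z}^n$. For an integer $l\ge0$, $\mathcal{P}^n(l)$ denotes the set of lattice $n$-polytopes $P$ with exactly $l$ interior lattice points, i.e. $\#(\mathrm{int}(P)\cap\mathbb{Z}^n)=l$, and $\mathcal{P}^n_0(l)$ denotes the set of those $P\in\mathcal{P}^n(l)$ which are $0$-symmetric ($P=-P$). (Since lattice points of a $0$-symmetric set come in pairs $\pm z$ apart from $0$, $\mathcal{P}_0^n(l)$ is empty for even $l$.) The Ehrhart polynomial of a lattice $n$-polytope $P$ is the unique polynomial $\mathrm{G}(s,P)=\sum_{i=0}^n \mathrm{G}_i(P)s^i$ with $\mathrm{G}(k,P)=\#(kP\cap\mathbb{Z}^n)$ for all positive integers $k$; it has degree $n$, constant term $1$ and leading coefficient $\mathrm{vol}(P)$. It is regarded as a polynomial in $s\in\mathbb{C}$ and factored as $\mathrm{G}(s,P)=\prod_{i=1}^n\left(1+\frac{s}{\gamma_i(P)}\right)$, so its roots with multiplicity are $-\gamma_1(P),\dots,-\gamma_n(P)$; in particular $\prod_i\gamma_i(P)=1/\mathrm{vol}(P)>0$. $\Gamma(n,l)\subset\mathbb{C}$ is the set of all $s\in\mathbb{C}$ with $\mathrm{G}(s,P)=0$ for some $P\in\mathcal{P}^n(l)$. A cluster point of a set $A\subset\mathbb{C}$ is a point every neighbourhood of which contains infinitely many elements of $A$. *)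

(* Defs.v *)
From mathcomp Require Import all_boot all_order all_algebra.
From mathcomp Require Import all_classical all_reals all_analysis.
From mathcomp Require Export complex.

Set Implicit Arguments.
Unset Strict Implicit.
Unset Printing Implicit Defensive.

Import Order.TTheory GRing.Theory Num.Theory numFieldNormedType.Exports.

Local Open Scope classical_set_scope.
Local Open Scope card_scope.
Local Open Scope ring_scope.

Section LatticePolytopes.
Variables (R : realType) (n : nat).
Implicit Types (A P : set 'rV[R]_n) (x y z : 'rV[R]_n).

Definition integer_lattice : set 'rV[R]_n :=
  [set x | forall i, x ord0 i \is a Num.int].

Definition convex_hull A : set 'rV[R]_n :=
  smallest (@convex_set R 'rV[R]_n) A.

Definition convex_polytope P : Prop :=
  exists s : seq 'rV[R]_n, P = convex_hull [set` s].

(* For a polytope, the vertices are its extreme points. *)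
Definition vertices P : set 'rV[R]_n :=
  [set x | P x /\ forall y z (t : R), P y -> P z -> 0 < t < 1 ->
                    x = (1 - t) *: y + t *: z -> y = x /\ z = x].

Definition affine_hull A : set 'rV[R]_n :=
  [set x | exists (m : nat) (v : 'I_m -> 'rV[R]_n) (w : 'I_m -> R),
     [/\ forall i, A (v i), \sum_i w i = 1 & x = \sum_i w i *: v i]].

(* The dimension of a set is that of its affine hull, written as a translate
   of the row space of V; the empty set has no dimension. *)
Definition has_dim A (d : nat) : Prop :=
  exists (x : 'rV[R]_n) (V : 'M[R]_n),
    affine_hull A = [set x + v | v in [set v : 'rV[R]_n | (v <= V)%MS]]
    /\ \rank V = d.

Definition lattice_polytope P : Prop :=
  [/\ convex_polytope P, has_dim P n & vertices P `<=` integer_lattice].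

Definition polytopes_with_interior_points (l : nat) : set (set 'rV[R]_n) :=
  [set P | lattice_polytope P /\ P^° `&` integer_lattice #= `I_l].

Definition symmetric_polytopes_with_interior_points (l : nat) :
    set (set 'rV[R]_n) :=
  [set P | polytopes_with_interior_points l P /\ P = -%R @` P].

Definition dilate (k : nat) P : set 'rV[R]_n := [set k%:R *: x | x in P].

Definition counts_lattice_points P (G : {poly R[i]}) : Prop :=
  forall k : nat, (0 < k)%N ->
    exists2 m : nat, dilate k P `&` integer_lattice #= `I_m
                   & G.[k%:R] = m%:R.

(* The polynomial is unique because it is prescribed at infinitely many points,
   and it exists for lattice polytopes by Ehrhart's theorem. The default value,
   never attained on those, is chosen without roots. *)
Definition ehrhart P : {poly R[i]} := xget 1 (counts_lattice_points P).

(* The condition gamma i != 0 is needed since 0^-1 = 0. *)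
Definition ehrhart_factorization P (gamma : 'I_n -> R[i]) : Prop :=
  (forall i, gamma i != 0) /\
  ehrhart P = \prod_(i < n) (1 + (gamma i)^-1 *: 'X).

End LatticePolytopes.

Definition Gamma (R : realType) (n l : nat) : set R[i] :=
  [set s | exists2 P : set 'rV[R]_n,
     polytopes_with_interior_points l P & root (ehrhart P) s].

Arguments Gamma R n l : clear implicits.

(* limit_point only asks for one point other than z in each neighbourhood. The
   topology of R[i] is the norm topology carried by the regular module. *)
Definition cluster_point (R : realType) (A : set R[i]) (z : R[i]) : Prop :=
  forall U : set R[i], nbhs (z : (R[i])^o) U -> infinite_set (U `&` A).

(* Main.v *)
(* (i) and the examples come from products [a, a + d] x P, whose lattice points,
   interior lattice points and counting polynomials are those of P multiplied
   by those of the segment; the root near 1 is a real root, given by the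
   intermediate value theorem, of the counting polynomials
   q (X^3 - X) + (X + 1)^2 of Reeve's tetrahedra.

   (ii) Let w be an interior lattice point of P and v a vertex, and write w as a
   convex combination of v and at most n + 1 further vertices in which the
   coefficient of v is nearly maximal. If that coefficient is too small,
   simultaneous Diophantine approximation of the other coefficients produces a
   translation vector d such that w, w + d, ..., w + l d are distinct interior
   lattice points. Hence w - c (P - w) is contained in P for some c > 0 depending
   only on n and l, and counting lattice points of k P modulo a multiple of k
   bounds their number in terms of n, l and k. So the counting polynomials have
   degree at most n and finitely many values at 1, ..., n + 1.

   (iii) If more than q (2k + 1)^n lattice points were in k P, then q + 1 of them
   would agree modulo 2k + 1; their differences with one of maximal norm, divided
   by 2k + 1, are, together with their opposites and 0, 2q + 1 distinct interior
   lattice points of P. So the leading coefficient, the inverse of the product of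
   the gamma_i, is at most 2^n (l + 1) / 2. *)
Require Import Defs.
From mathcomp Require Import all_boot all_order all_algebra.
From mathcomp Require Import all_classical all_reals all_analysis.
From mathcomp Require Import ring lra zify.
Set Implicit Arguments.
Unset Strict Implicit.
Unset Printing Implicit Defensive.

Import Order.TTheory GRing.Theory Num.Theory numFieldNormedType.Exports.
Local Open Scope classical_set_scope.
Local Open Scope card_scope.
Local Open Scope ring_scope.

(** * Convex hulls, Carathéodory's theorem and extreme points *)

Section Convexity.
Variables (R : realType) (n : nat).
Implicit Types (A P H : set 'rV[R]_n) (x y z : 'rV[R]_n).

Lemma convex_setE A : @convex_set R 'rV[R]_n A <->
  forall x y (a b : R), 0 <= a -> 0 <= b -> a + b = 1 -> A x -> A y ->
    A (a *: x + b *: y).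
Proof.
split=> [cA x y a b a0 b0 ab Ax Ay|cA x y k /set_mem Ax /set_mem Ay].
  have k01 : Itv.spec (@Itv.num_sem R) (Itv.Real `[0%Z, 1%Z]) a.
    by rewrite /= /Itv.num_sem /= num_real /= in_itv /= a0 /= -ab lerDl.
  have /set_mem := cA x y (Itv.mk k01) (mem_set Ax) (mem_set Ay).
  by rewrite /conv /= /unstable.onem -ab addrAC subrr add0r.
apply/mem_set; apply: cA => //; first by rewrite unstable.onem_ge0.
by rewrite /unstable.onem addrC subrK.
Qed.

Lemma interior_boxP P x :
  P° x <-> exists2 e : R, 0 < e & forall y, (forall i, `|x 0 i - y 0 i| < e) -> P y.
Proof.
split=> [/nbhs_ballP[e /= e0 eP]|[e e0 eP]].
  exists e => // y xy; apply: eP; split=> // i j.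
  by rewrite (ord1 i) /ball /=; exact: xy.
apply/nbhs_ballP; exists e => // y [_ xy]; apply: eP => i.
exact: xy.
Qed.

(* [cone_over H b z] says that z = b h for some h in H, where b = 0 also forces
   z = 0 when H is empty: it makes convex combinations additive. *)
Definition cone_over H (b : R) z :=
  (b = 0 /\ z = 0) \/ (0 < b /\ H (b^-1 *: z)).

Lemma cone_over1 H z : cone_over H 1 z <-> H z.
Proof.
rewrite /cone_over invr1 scale1r; split=> [[[/eqP]|[]//]|Hz].
  by rewrite oner_eq0.
by right.
Qed.

Lemma cone_over0 H : cone_over H 0 0.
Proof. by left. Qed.

Lemma cone_over_ge0 H b z : cone_over H b z -> 0 <= b.
Proof. by case=> -[]; [move=> -> | move/ltW]. Qed.

Lemma cone_over_scale H a b z : 0 <= a -> cone_over H b z -> cone_over H (a * b) (a *: z).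
Proof.
rewrite le_eqVlt => /predU1P[<- _|a0]; first by rewrite mul0r scale0r; left.
case=> [[-> ->]|[b0 Hz]]; first by rewrite mulr0 scaler0; left.
right; split; first exact: mulr_gt0.
by rewrite scalerA invfM mulrAC mulVf ?gt_eqF// mul1r.
Qed.

Lemma cone_over_mem H b z : 0 <= b -> H z -> cone_over H b (b *: z).
Proof.
by move=> b0 Hz; rewrite -[b in cone_over _ b _]mulr1; apply: cone_over_scale => //;
  apply/cone_over1.
Qed.

Lemma cone_overD H b1 b2 z1 z2 : @convex_set R 'rV[R]_n H ->
  cone_over H b1 z1 -> cone_over H b2 z2 -> cone_over H (b1 + b2) (z1 + z2).
Proof.
move=> /convex_setE cH [[-> ->]|[b10 Hz1]]; first by rewrite !add0r.
move=> [[-> ->]|[b20 Hz2]]; first by rewrite !addr0; right.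
have b0 : 0 < b1 + b2 by rewrite addr_gt0.
right; split => //.
have -> : (b1 + b2)^-1 *: (z1 + z2) =
  (b1 / (b1 + b2)) *: (b1^-1 *: z1) + (b2 / (b1 + b2)) *: (b2^-1 *: z2).
  rewrite !scalerA scalerDr; congr (_ *: _ + _ *: _).
  - by rewrite mulrAC mulfV ?gt_eqF// mul1r.
  - by rewrite mulrAC mulfV ?gt_eqF// mul1r.
apply: cH => //; try by rewrite divr_ge0 ?ltW.
by rewrite -mulrDl mulfV// gt_eqF.
Qed.

Lemma cone_over_sum H (I : finType) (Q : pred I) (w : I -> R) (v : I -> 'rV[R]_n) :
  @convex_set R 'rV[R]_n H -> (forall i, Q i -> 0 <= w i) -> (forall i, Q i -> H (v i)) ->
  cone_over H (\sum_(i | Q i) w i) (\sum_(i | Q i) w i *: v i).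
Proof.
move=> cH w0 Hv.
elim/big_ind2 : _ => [|*|i Qi]; [exact: cone_over0|exact: cone_overD|].
by apply: cone_over_mem; [exact: w0|exact: Hv].
Qed.

Lemma convex_combination_in H (I : finType) (w : I -> R) (v : I -> 'rV[R]_n) :
  @convex_set R 'rV[R]_n H -> (forall i, 0 <= w i) -> (forall i, H (v i)) ->
  \sum_i w i = 1 -> H (\sum_i w i *: v i).
Proof.
move=> cH w0 Hv w1; apply/cone_over1; rewrite -w1.
exact: cone_over_sum.
Qed.

Lemma convex_hull_convex A : @convex_set R 'rV[R]_n (convex_hull A).
Proof.
apply/convex_setE => x y a b a0 b0 ab Hx Hy B [cB AB].
by move/convex_setE : (cB); apply => //; [apply: Hx|apply: Hy].
Qed.

Lemma sub_convex_hull A : A `<=` convex_hull A.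
Proof. by move=> x Ax B [_]; apply. Qed.

Lemma convex_hull_sub A P : @convex_set R 'rV[R]_n P -> A `<=` P -> convex_hull A `<=` P.
Proof. by move=> cP AP x; apply; split. Qed.

Definition convex_comb m A x :=
  exists (v : 'I_m -> 'rV[R]_n) (w : 'I_m -> R),
    [/\ forall i, A (v i), forall i, 0 <= w i, \sum_i w i = 1 & x = \sum_i w i *: v i].

Lemma convex_hullP A x : convex_hull A x <-> exists m, convex_comb m A x.
Proof.
split=> [|[m [v [w [Av w0 w1 ->]]]]]; last first.
  apply: convex_combination_in => //; first exact: convex_hull_convex.
  by move=> i; exact: sub_convex_hull.
apply: (@convex_hull_sub A [set x | exists m, convex_comb m A x]); last first.
  move=> {}x Ax; exists 1%N, (fun=> x), (fun=> 1).
  by rewrite !big_ord1 scale1r; split.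
apply/convex_setE => {}x y a b a0 b0 ab [m1 [v1 [w1 [Av1 w10 w11 ->]]]]
  [m2 [v2 [w2 [Av2 w20 w21 ->]]]].
exists (m1 + m2)%N, (fun i => match fintype.split i with inl j => v1 j | inr j => v2 j end),
  (fun i => match fintype.split i with inl j => a * w1 j | inr j => b * w2 j end).
have spl i : fintype.split (lshift m2 i) = inl i := unsplitK (inl i).
have spr i : fintype.split (rshift m1 i) = inr i := unsplitK (inr i).
split.
- by move=> i; case: fintype.split.
- by move=> i; case: fintype.split => j; apply: mulr_ge0.
- rewrite big_split_ord /=.
  under eq_bigr do rewrite spl.
  under [X in _ + X]eq_bigr do rewrite spr.
  by rewrite -!mulr_sumr w11 w21 !mulr1.
- rewrite big_split_ord /= !scaler_sumr.
  congr (_ + _); apply: eq_bigr => i _.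
    by rewrite spl scalerA.
  by rewrite spr scalerA.
Qed.

Lemma convex_comb_drop m A (v : 'I_m.+1 -> 'rV[R]_n) (w : 'I_m.+1 -> R) i0 :
  (forall i, A (v i)) -> (forall i, 0 <= w i) -> \sum_i w i = 1 -> w i0 = 0 ->
  convex_comb m A (\sum_i w i *: v i).
Proof.
move=> Av w0 w1 wi0; exists (v \o lift i0), (w \o lift i0); split => //=.
- by move: w1; rewrite (bigD1_ord i0) //= wi0 add0r.
- by rewrite (bigD1_ord i0) //= wi0 scale0r add0r.
Qed.

(** The rows ([v i], 1) are more than n + 1 vectors in dimension n + 1, hence linearly dependent.
    The last column makes the coefficients sum to 0, so a nonzero relation has a positive one. *)
Lemma affine_dependency m (v : 'I_m -> 'rV[R]_n) : (n.+1 < m)%N ->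
  exists u : 'I_m -> R, [/\ exists i, 0 < u i, \sum_i u i = 0 & \sum_i u i *: v i = 0].
Proof.
move=> nm.
pose M : 'M[R]_(m, n + 1) := row_mx (\matrix_i v i) (const_mx 1).
have : kermx M != 0.
  rewrite kermx_eq0 /row_free neq_ltn (leq_ltn_trans (rank_leq_col _))//.
  by rewrite addn1.
case/rowV0Pn => u /sub_kermxP; rewrite mul_mx_row -row_mx0 => /eq_row_mx[uv u1] u0.
have su : \sum_i u 0 i = 0.
  have /matrixP/(_ 0 0) := u1; rewrite !mxE => uE.
  by rewrite -[RHS]uE; apply: eq_bigr => i _; rewrite mxE mulr1.
have suv : \sum_i u 0 i *: v i = 0.
  rewrite -[RHS]uv mulmx_sum_row; apply: eq_bigr => i _.
  by rewrite rowK.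
exists (u 0); split => //.
apply: contrapT => /forallNP un.
have un0 i : u 0 i <= 0 by have := un i; move/negP; rewrite -leNgt.
case/eqP : u0; apply/rowP => i; rewrite mxE.
have /eqP : \sum_i - u 0 i = 0 by rewrite sumrN su oppr0.
rewrite psumr_eq0; last by move=> j _; rewrite oppr_ge0.
by move/allP => /(_ i (mem_index_enum i)) /=; rewrite oppr_eq0 => /eqP.
Qed.

(** While there are more than n + 1 points, a multiple of an affine dependency [u] is subtracted
    from the weights. The multiple is the least ratio [w i / u i] over positive [u i]: all weights
    stay nonnegative and one vanishes. *)
Lemma caratheodory A x : convex_hull A x -> exists2 m, (m <= n.+1)%N & convex_comb m A x.
Proof.
case/convex_hullP => m; elim: m x => [|m IH] x.
  by move=> h; exists 0%N.
have [mn h|mn] := leqP m.+1 n.+1; first by exists m.+1.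
move=> [v [w [Av w0 w1 ->]]].
have [u [[i1 ui1] su suv]] := affine_dependency v mn.
pose t i := w i / u i.
have [i0 /= ui0 hmin] := @arg_minP _ _ _ i1 (fun i => 0 < u i) t ui1.
have twi i : 0 <= w i - t i0 * u i.
  have [ui|ui] := ltP 0 (u i); last first.
    by rewrite subr_ge0 (le_trans _ (w0 i))// mulr_ge0_le0// divr_ge0// ltW.
  by rewrite subr_ge0 -ler_pdivlMr//; exact: hmin.
apply: IH; have -> : \sum_i w i *: v i = \sum_i (w i - t i0 * u i) *: v i.
  under [RHS]eq_bigr do rewrite scalerBl -scalerA.
  by rewrite sumrB -scaler_sumr suv scaler0 subr0.
apply: (convex_comb_drop (i0 := i0)) => //.
- by rewrite sumrB -mulr_sumr su mulr0 subr0.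
- by rewrite /t mulfVK ?subrr// gt_eqF.
Qed.

(** Isolating an index of positive weight writes x as a combination of [v i] and the normalized
    rest. If the rest has weight 0, then x is [v i]; otherwise extremality gives the same. *)
Lemma extreme_point_hull A x : vertices (convex_hull A) x -> A x.
Proof.
move=> [/convex_hullP[m [v [w [Av w0 w1 xE]]]] ext].
have [i wi] : exists i, 0 < w i.
  apply: contrapT => /forallNP wn.
  have : \sum_i w i = 0.
    rewrite big1// => i _; apply/eqP; rewrite eq_le w0 andbT leNgt.
    exact/negP.
  by rewrite w1 => /eqP; rewrite oner_eq0.
have cr : cone_over (convex_hull A) (\sum_(j | j != i) w j) (\sum_(j | j != i) w j *: v j).
  by apply: cone_over_sum => *; [exact: convex_hull_convex| |exact: sub_convex_hull].
have wE : w i = 1 - \sum_(j | j != i) w j by rewrite -w1 (bigD1 i)//= addrK.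
move: xE; rewrite (bigD1 i)//=; case: cr => [[-> ->]|[s0 hs]] in wE *.
  by rewrite wE subr0 scale1r addr0 => ->.
set z := \sum_(j | _) w j *: v j in hs *; set s := \sum_(j | _) w j in hs s0 wE *.
move=> xE; have [] := ext (v i) (s^-1 *: z) s.
- exact: sub_convex_hull.
- exact: hs.
- by rewrite s0 /= -subr_gt0 -wE.
- by rewrite -wE scalerA mulfV ?gt_eqF// scale1r.
by move=> <-.
Qed.

(** The form on the right is stable under convex combinations; the weight b = 0 covers x itself,
    even when [A] is empty. *)
Lemma hull_setU1 x A y : convex_hull (x |` A) y ->
  exists a b z, [/\ 0 <= a, a + b = 1, cone_over (convex_hull A) b z & y = a *: x + z].
Proof.
apply: (@convex_hull_sub _ [set y | exists a b z,
  [/\ 0 <= a, a + b = 1, cone_over (convex_hull A) b z & y = a *: x + z]]).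
  apply/convex_setE => y1 y2 s t s0 t0 st [a1 [b1 [z1 [a10 ab1 c1 ->]]]]
    [a2 [b2 [z2 [a20 ab2 c2 ->]]]].
  exists (s * a1 + t * a2), (s * b1 + t * b2), (s *: z1 + t *: z2); split.
  - by rewrite addr_ge0// mulr_ge0.
  - by rewrite addrACA -!mulrDr ab1 ab2 !mulr1.
  - by apply: cone_overD; [exact: convex_hull_convex|exact: cone_over_scale..].
  - by rewrite !scalerDr !scalerA addrACA scalerDl.
move=> {}y [->|Az].
- by exists 1, 0, 0; split => //; rewrite ?addr0// ?scale1r ?addr0//; exact: cone_over0.
- exists 0, 1, y; rewrite add0r scale0r add0r; split => //.
  by apply/cone_over1; exact: sub_convex_hull.
Qed.

Lemma hull_setU1_id x A : convex_hull A x -> convex_hull (x |` A) = convex_hull A.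
Proof.
move=> hx; apply/seteqP; split; apply: convex_hull_sub.
- exact: convex_hull_convex.
- by move=> y [->//|]; exact: sub_convex_hull.
- exact: convex_hull_convex.
- by move=> y Ay; apply: sub_convex_hull; right.
Qed.

(** If x lies between two points of the hull, the total weight of [A] in the combination is 0, since
    dividing by a positive one would put x into the hull of [A]. So both points are x. *)
Lemma extreme_point_setU1 x A : ~ convex_hull A x -> vertices (convex_hull (x |` A)) x.
Proof.
move=> nx; split; first by apply: sub_convex_hull; left.
have red a b z : a + b = 1 -> cone_over (convex_hull A) b z -> x = a *: x + z -> b = 0.
  move=> ab [[]//|[b0 hz]] xE; case: nx.
  suff <- : b^-1 *: z = x by [].
  have -> : z = b *: x by apply: (addrI (a *: x)); rewrite -xE -scalerDl ab scale1r.
  by rewrite scalerA mulVf ?gt_eqF// scale1r.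
move=> y z t /hull_setU1[a1 [b1 [z1 [a10 ab1 c1 ->]]]]
  /hull_setU1[a2 [b2 [z2 [a20 ab2 c2 ->]]]] /andP[t0 t1] xE.
have t1' : 0 < 1 - t by rewrite subr_gt0.
have : (1 - t) * b1 + t * b2 = 0.
  apply: (red ((1 - t) * a1 + t * a2) _ ((1 - t) *: z1 + t *: z2)).
  - by rewrite addrACA -!mulrDr ab1 ab2 !mulr1 subrK.
  - by apply: cone_overD; [exact: convex_hull_convex|apply: cone_over_scale => //; exact: ltW..].
  - by rewrite {1}xE !scalerDr !scalerA addrACA -(scalerDl x).
have b10 := cone_over_ge0 c1; have b20 := cone_over_ge0 c2.
move/eqP; rewrite paddr_eq0 ?mulr_ge0// ?ltW// !mulf_eq0 (gt_eqF t0) (gt_eqF t1') /=.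
move=> /andP[/eqP b1E /eqP b2E].
have c0 z' : cone_over (convex_hull A) 0 z' -> z' = 0 by case=> [[]//|[]]; rewrite ltxx.
move: c1 c2 ab1 ab2; rewrite b1E b2E !addr0 => /c0 -> /c0 -> -> ->.
by rewrite scale1r addr0.
Qed.

(** Generators lying in the hull of the others are discarded one at a time; when none is left, every
    generator is extreme. *)
Lemma hull_extreme_points (s : seq 'rV[R]_n) :
  exists2 s' : seq 'rV[R]_n, convex_hull [set` s'] = convex_hull [set` s] &
    [set` s'] `<=` vertices (convex_hull [set` s]).
Proof.
have [k] := ubnP (size s); elim: k s => // k IH s sk.
have [[x xs hx]|nex] := pselect (exists2 x, x \in s & convex_hull [set` rem x s] x).
  have E : convex_hull [set` s] = convex_hull [set` rem x s].
    rewrite -(hull_setU1_id hx); congr convex_hull; apply/seteqP; split => y /=.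
      by rewrite (perm_mem (perm_to_rem xs)) inE => /predU1P[->|]; [left|right].
    by rewrite (perm_mem (perm_to_rem xs)) inE => -[->|->]; rewrite ?eqxx ?orbT.
  rewrite E; apply: IH; rewrite size_rem//.
  by case: (s) xs sk.
exists s => // x /= xs.
have E : [set` s] = x |` [set` rem x s].
  apply/seteqP; split => y /=.
    by rewrite (perm_mem (perm_to_rem xs)) inE => /predU1P[->|]; [left|right].
  by rewrite (perm_mem (perm_to_rem xs)) inE => -[->|->]; rewrite ?eqxx ?orbT.
rewrite E; apply: extreme_point_setU1 => hx; apply: nex.
by exists x.
Qed.

(** A box of radius [e] around w inside [P] yields one of radius [a * e] around the combination. *)
Lemma interior_cone_over P w (a b : R) z : @convex_set R 'rV[R]_n P -> P° w ->
  0 < a -> a + b = 1 -> cone_over P b z -> P° (a *: w + z).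
Proof.
move=> cP /interior_boxP[e e0 eP] a0 ab cz; apply/interior_boxP.
exists (a * e); first exact: mulr_gt0.
move=> y hy; apply/cone_over1; rewrite -ab.
rewrite -[y](subrK z); apply: cone_overD => //.
rewrite -[y - z]scale1r -(mulfV (lt0r_neq0 a0)) -scalerA.
apply: cone_over_mem; first exact: ltW.
apply: eP => i; rewrite !mxE.
have := hy i; rewrite !mxE -ltr_pdivrMl//.
apply: le_lt_trans; rewrite -[X in X * `|_|](gtr0_norm (x := a^-1)) ?invr_gt0//.
rewrite -normrM le_eqVlt; apply/orP; left; apply/eqP; congr `|_|.
by field; rewrite gt_eqF.
Qed.

End Convexity.

(** * Full dimension as nonempty interior *)

Section FullDimension.
Variables (R : realType) (n : nat).
Implicit Types (A P : set 'rV[R]_n) (x y z : 'rV[R]_n).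

Lemma affine_hull_cone P z : @convex_set R 'rV[R]_n P -> affine_hull P z ->
  exists p q a b, [/\ p = 1 + q, cone_over P p a, cone_over P q b & z = a - b].
Proof.
move=> cP [m [v [w [Pv w1 ->]]]].
exists (\sum_(i | 0 <= w i) w i), (\sum_(i | ~~ (0 <= w i)) - w i),
  (\sum_(i | 0 <= w i) w i *: v i), (\sum_(i | ~~ (0 <= w i)) - w i *: v i); split.
- by rewrite sumrN -w1 [X in _ = X - _](bigID (fun i => 0 <= w i))/= addrK.
- exact: cone_over_sum.
- by apply: cone_over_sum => // i; rewrite -ltNge oppr_ge0 => /ltW.
- rewrite (bigID (fun i => 0 <= w i))/=; congr (_ + _).
  by rewrite -sumrN; apply: eq_bigr => i _; rewrite scaleNr opprK.
Qed.

(** Separating weights by sign leaves a surplus of 1 on the positive side. Representing 0 the same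
    way gives one vector [b2] carrying both weights [q2] and [1 + q2]; adding it to the two sides
    with these weights evens out the totals. *)
Lemma affine_hullT_cone P z : @convex_set R 'rV[R]_n P -> affine_hull P = setT ->
  exists s a b, [/\ 0 <= s, cone_over P s a, cone_over P s b & z = a - b].
Proof.
move=> cP PT.
have hz : affine_hull P z by rewrite PT.
have h0 : affine_hull P 0 by rewrite PT.
have [p1 [q1 [a1 [b1 [-> ca1 cb1 ->]]]]] := affine_hull_cone cP hz.
have [p2 [q2 [a2 [b2 [pq2 ca2 cb2 /eqP]]]]] := affine_hull_cone cP h0.
rewrite eq_sym subr_eq0 => /eqP ab2; rewrite {}pq2 {}ab2 in ca2.
exists (1 + q1 + q2), (a1 + b2), (b1 + b2); split.
- by rewrite !addr_ge0// ?(cone_over_ge0 cb1)// (cone_over_ge0 cb2).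
- exact: cone_overD.
- rewrite -addrA addrCA; exact: cone_overD.
- by rewrite opprD addrACA subrr addr0.
Qed.

(** Each unit vector is [a i - b i] with two cone elements of equal weight. The normalized sum of
    [x0] and all [a i + b i] is interior: moving it by small [d i] along the axes changes the
    coefficients to [1 + d i] and [1 - d i], still positive and of the same total weight. *)
Lemma affine_hullT_interior P : @convex_set R 'rV[R]_n P -> affine_hull P = setT ->
  exists x, P° x.
Proof.
move=> cP PT.
have [x0 Px0] : exists x, P x.
  have [m [v [w [Pv w1 _]]]] : affine_hull P 0 by rewrite PT.
  case: m v w Pv w1 => [|m] v w Pv; first by rewrite big_ord0 => /eqP; rewrite eq_sym oner_eq0.
  by exists (v 0).
have /choice[s /choice[a /choice[b h]]] :
    forall i : 'I_n, exists s a b, [/\ 0 <= s, cone_over P s a, cone_over P s b &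
      delta_mx 0 i = a - b].
  by move=> i; exact: affine_hullT_cone.
pose S := 1 + \sum_i (s i + s i).
have S0 : 0 < S.
  by rewrite ltr_pwDl// sumr_ge0// => i _; rewrite addr_ge0//; case: (h i).
pose C := x0 + \sum_i (a i + b i).
exists (S^-1 *: C); apply/interior_boxP; exists S^-1; first by rewrite invr_gt0.
move=> y hy; pose d i := S * y 0 i - C 0 i.
have hd i : `|d i| < 1.
  have := hy i; rewrite -(ltr_pM2l S0) mulfV ?gt_eqF//.
  rewrite -{1}(gtr0_norm S0) -normrM mxE mulrBr mulrA mulfV ?gt_eqF// mul1r.
  by rewrite distrC.
have Sy i : S * y 0 i = C 0 i + d i by rewrite /d addrC subrK.
clearbody d.
have hS : S = 1 + \sum_i ((1 + d i) * s i + (1 - d i) * s i).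
  by congr (_ + _); apply: eq_bigr => i _; ring.
suff : cone_over P S (S *: y).
  move/(cone_over_scale (a := S^-1)); rewrite scalerA mulVf ?gt_eqF// scale1r => H.
  by apply/cone_over1/H; rewrite invr_ge0 ltW.
have -> : S *: y = x0 + \sum_i ((1 + d i) *: a i + (1 - d i) *: b i).
  transitivity (C + \sum_i d i *: delta_mx 0 i).
    have dE i j : (d i *: delta_mx 0 i : 'rV[R]_n) 0 j = d i * (j == i)%:R.
      by rewrite !mxE eqxx.
    apply/rowP => j; rewrite mxE [RHS]mxE summxE (bigD1 j)//= dE eqxx mulr1.
    rewrite big1 => [|i ij]; last by rewrite dE eq_sym (negbTE ij) mulr0.
    by rewrite addr0.
  rewrite /C -addrA -big_split/=; congr (_ + _); apply: eq_bigr => i _.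
  have [_ _ _ ->] := h i.
  by rewrite scalerBr !scalerDl !scale1r scaleNr addrACA.
rewrite {1}hS; apply: cone_overD => //; first exact/cone_over1.
elim/big_ind2 : _ => [|*|i _]; [exact: cone_over0|exact: cone_overD|].
have [_ ca cb _] := h i; have := hd i; rewrite ltr_norml => /andP[h1 h2].
by apply: cone_overD => //; apply: cone_over_scale => //; lra.
Qed.

Lemma interior_step P x z : P° x -> exists2 t : R, 0 < t & P (x + t *: (z - x)).
Proof.
move=> /interior_boxP[e e0 eP].
pose D := 1 + \sum_i `|z 0 i - x 0 i|.
have D0 : 0 < D by rewrite ltr_pwDl// sumr_ge0.
have t0 : 0 < e / D by rewrite divr_gt0.
exists (e / D) => //; apply: eP => j.
rewrite !mxE opprD addrA subrr add0r normrN normrM (gtr0_norm t0).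
rewrite mulrAC ltr_pdivrMr// ltr_pM2l//.
rewrite /D (bigD1 j)//= addrCA ltrDl ltr_pwDl//.
by rewrite sumr_ge0.
Qed.

Lemma interior_affine_hullT P x : P° x -> affine_hull P = setT.
Proof.
move=> Px; apply/seteqP; split => // z _.
have [t t0 Pt] := interior_step z Px.
exists 2%N, (fun i => if i == 0 then x else x + t *: (z - x)),
  (fun i => if i == 0 then 1 - t^-1 else t^-1); split.
- by move=> i; case: eqP => // _; exact: interior_subset.
- by rewrite big_ord_recl big_ord1 /= subrK.
- rewrite big_ord_recl big_ord1 /= scalerDr scalerA mulVf ?gt_eqF// scale1r.
  by rewrite addrA -scalerDl subrK scale1r addrC subrK.
Qed.

Lemma has_full_dimP P : @convex_set R 'rV[R]_n P -> has_dim P n <-> exists x, P° x.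
Proof.
move=> cP; split=> [[x [V [PE rV]]]|[x /interior_affine_hullT PT]].
  apply: affine_hullT_interior => //; rewrite PE; apply/seteqP; split => // z _.
  exists (z - x); last by rewrite addrC subrK.
  by apply: submx_full; rewrite /row_full rV.
exists 0, 1%:M; split; last exact: mxrank1.
rewrite PT; apply/seteqP; split => // z _; exists z; last by rewrite add0r.
exact: submx1.
Qed.

(** Replacing the generators by the extreme points turns the condition on the vertices into one on
    the generating list. *)
Lemma lattice_polytopeP P : lattice_polytope P <->
  exists s : seq 'rV[R]_n, [/\ P = convex_hull [set` s],
    [set` s] `<=` @integer_lattice R n & exists x, P° x].
Proof.
split=> [[[s PE] dP vP]|[s [PE sZ xP]]].
  have cP : @convex_set R 'rV[R]_n P by rewrite PE; exact: convex_hull_convex.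
  have [s' s'E s'v] := hull_extreme_points s; exists s'; split.
  - by rewrite s'E.
  - by move=> x /s'v xv; apply: vP; rewrite PE.
  - exact/has_full_dimP.
have cP : @convex_set R 'rV[R]_n P by rewrite PE; exact: convex_hull_convex.
split; [by exists s|exact/has_full_dimP|].
by rewrite PE => x /extreme_point_hull; exact: sZ.
Qed.

End FullDimension.

(** * Finite cardinals and injections *)

Section FiniteCardinals.

Lemma range_card (T : Type) (F : finType) (f : F -> T) :
  injective f -> range f #= `I_#|F|.
Proof.
move=> fI.
have -> : range f = range (f \o @enum_val F predT).
  apply/seteqP; split => _ [i _ <-]; last by exists (enum_val i).
  by exists (enum_rank i) => //=; rewrite enum_rankK.
rewrite card_eq_sym; apply: (card_eq_trans card_II); rewrite card_eq_sym.
by apply: inj_card_eq => i j _ _ /= /fI /enum_val_inj.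
Qed.

Lemma card_range (T : pointedType) (A : set T) m : A #= `I_m ->
  exists2 f : 'I_m -> T, injective f & A = range f.
Proof.
rewrite card_eq_sym => Am.
have : [set: 'I_m] #= A by apply: card_eq_trans Am; rewrite card_eq_sym; exact: card_II.
move/card_set_bijP => [f fb]; exists f.
  by move=> i j; apply: (set_bij_inj fb); rewrite in_setT.
apply/seteqP; split; first exact: set_bij_surj.
exact: set_bij_sub.
Qed.

Lemma inj_leq_card (T : Type) (A : set T) l (F : finType) (f : F -> T) :
  A #= `I_l -> injective f -> (forall i, A (f i)) -> (#|F| <= l)%N.
Proof.
move=> Al fI fA; rewrite -card_le_II -(card_le_eqr Al) -(card_le_eql (range_card fI)).
by apply: subset_card_le => _ [i _ <-].
Qed.

End FiniteCardinals.

(** * Products of a lattice segment with a polytope *)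

Section SegmentProduct.
Variables (R : realType) (m : nat).
Implicit Types (P : set 'rV[R]_m) (x y : 'rV[R]_(1 + m)) (a : int) (d k : nat).

Definition segment_prod a d P : set 'rV[R]_(1 + m) :=
  [set x | a%:~R <= lsubmx x 0 0 <= a%:~R + d%:R /\ P (rsubmx x)].

Lemma row_mx1E x : x = row_mx (lsubmx x 0 0)%:M (rsubmx x).
Proof. by rewrite -[LHS]hsubmxK [lsubmx x in LHS]mx11_scalar. Qed.

Lemma row_mx1Kl (t : R) (y : 'rV[R]_m) : lsubmx (row_mx t%:M y) 0 0 = t.
Proof. by rewrite row_mxKl mxE eqxx mulr1n. Qed.

Lemma row_mx1_inj (t u : R) (y z : 'rV[R]_m) :
  row_mx t%:M y = row_mx u%:M z -> t = u /\ y = z.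
Proof.
move=> /eq_row_mx[/matrixP/(_ 0 0) + ->].
by rewrite !mxE eqxx !mulr1n.
Qed.

Lemma row_mx1D (t u b c : R) (y z : 'rV[R]_m) :
  b *: row_mx t%:M y + c *: row_mx u%:M z = row_mx (b * t + c * u)%:M (b *: y + c *: z).
Proof. by rewrite !scale_row_mx add_row_mx !scale_scalar_mx -raddfD. Qed.

Lemma segment_prod_row a d P (t : R) (y : 'rV[R]_m) :
  segment_prod a d P (row_mx t%:M y) <-> a%:~R <= t <= a%:~R + d%:R /\ P y.
Proof. by rewrite /segment_prod /= row_mx1Kl row_mxKr. Qed.

Lemma segment_prod_convex a d P : @convex_set R 'rV[R]_m P ->
  @convex_set R 'rV[R]_(1 + m) (segment_prod a d P).
Proof.
move=> /convex_setE cP; apply/convex_setE => x y b c b0 c0 bc.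
rewrite (row_mx1E x) (row_mx1E y) row_mx1D !segment_prod_row.
move: (lsubmx x 0 0) (lsubmx y 0 0) (rsubmx x) (rsubmx y) => t u x' y'.
move=> [/andP[t1 t2] Px] [/andP[u1 u2] Py]; split; last exact: cP.
have -> : c = 1 - b by rewrite -bc addrAC subrr add0r.
have c0' : 0 <= 1 - b by rewrite subr_ge0 -bc lerDl.
by apply/andP; split; nra.
Qed.

(** For a fixed first coordinate t, the y with (t, y) in the right-hand hull form a convex set, so
    only generators z matter; there (t, z) lies on the segment joining the two end copies of z. *)
Lemma segment_prod_hull a d (s : seq 'rV[R]_m) : (0 < d)%N ->
  segment_prod a d (convex_hull [set` s]) =
  convex_hull [set` [seq row_mx a%:~R%:M z | z <- s] ++
                    [seq row_mx (a%:~R + d%:R)%:M z | z <- s]].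
Proof.
move=> d0; have dR : 0 < d%:R :> R by rewrite ltr0n.
apply/seteqP; split => x; last first.
  apply: convex_hull_sub; first exact/segment_prod_convex/convex_hull_convex.
  move=> z /=; rewrite mem_cat => /orP[] /mapP[y ys ->]; apply/segment_prod_row.
    by split; [rewrite lexx lerDl ltW|exact: sub_convex_hull].
  by split; [rewrite lexx lerDl ltW|exact: sub_convex_hull].
rewrite (row_mx1E x) segment_prod_row.
move: (lsubmx x 0 0) (rsubmx x) => t y [/andP[t1 t2]]; set H := (X in X (row_mx _ _)).
have /convex_setE cH : @convex_set R 'rV[R]_(1 + m) H by exact: convex_hull_convex.
apply: (@convex_hull_sub _ _ _ [set y | H (row_mx t%:M y)]) => [|z zs /=].
  apply/convex_setE => y1 y2 b c b0 c0 bc /= H1 H2.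
  have := cH _ _ b c b0 c0 bc H1 H2.
  by rewrite row_mx1D -mulrDl bc mul1r.
pose u := (t - a%:~R) / d%:R.
have u0 : 0 <= u by rewrite divr_ge0 ?subr_ge0// ltW.
have u1 : 0 <= 1 - u by rewrite subr_ge0 ler_pdivrMr// mul1r lerBlDl.
have -> : row_mx t%:M z = (1 - u) *: row_mx a%:~R%:M z + u *: row_mx (a%:~R + d%:R)%:M z.
  rewrite row_mx1D -scalerDl subrK scale1r; congr (row_mx _%:M _).
  by rewrite /u; field; rewrite gt_eqF.
apply: cH => //; rewrite ?subrK//; apply: sub_convex_hull => /=; rewrite mem_cat.
  by apply/orP; left; apply: map_f.
by apply/orP; right; apply: map_f.
Qed.

Lemma segment_prod_interior a d P x :
  (segment_prod a d P)° x <->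
  a%:~R < lsubmx x 0 0 < a%:~R + d%:R /\ P° (rsubmx x).
Proof.
rewrite {1}(row_mx1E x); move: (lsubmx x 0 0) (rsubmx x) => t y {x}.
have near (z : 'rV[R]_m) (u e : R) : (forall i, `|row_mx t%:M y 0 i - row_mx u%:M z 0 i| < e) <->
    `|t - u| < e /\ (forall i, `|y 0 i - z 0 i| < e).
  split=> [h|[h1 h2] i].
    split=> [|i]; first by have := h (lshift m 0); rewrite !row_mxEl !mxE eqxx !mulr1n.
    by have := h (rshift 1 i); rewrite !row_mxEr.
  case: (split_ordP i) => j ->; last by rewrite !row_mxEr.
  by rewrite !row_mxEl !mxE (ord1 j) eqxx !mulr1n.
split=> [/interior_boxP[e e0 eP]|[/andP[t1 t2] /interior_boxP[e e0 eP]]].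
  have h u (z : 'rV[R]_m) : `|t - u| < e -> (forall i, `|y 0 i - z 0 i| < e) ->
      a%:~R <= u <= a%:~R + d%:R /\ P z.
    by move=> h1 h2; apply/segment_prod_row/eP/near.
  have ey i : `|y 0 i - y 0 i| < e by rewrite subrr normr0.
  split; last first.
    by apply/interior_boxP; exists e => // z /h h'; apply: (h' t _).2; rewrite subrr normr0.
  have [|/andP[h1 _] _] := h (t - e / 2) y _ ey.
    by rewrite opprB addrC subrK gtr0_norm; lra.
  have [|/andP[_ h2] _] := h (t + e / 2) y _ ey.
    by rewrite opprD addrA subrr add0r normrN gtr0_norm; lra.
  by apply/andP; split; lra.
apply/interior_boxP; exists (Num.min e (Num.min (t - a%:~R) (a%:~R + d%:R - t))).
  by rewrite !lt_min e0 !subr_gt0 t1.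
move=> x; rewrite (row_mx1E x) => /near; rewrite !lt_min => -[/and3P[h1 h2 h3] h4].
apply/segment_prod_row; split.
  by move: h2 h3; rewrite !ltr_norml => /andP[_ h2] /andP[h3 _]; apply/andP; split; lra.
by apply: eP => i; have := h4 i; rewrite !lt_min => /andP[].
Qed.

Lemma row_mx_lattice (t : R) (y : 'rV[R]_m) :
  @integer_lattice R (1 + m) (row_mx t%:M y) <->
  t \is a Num.int /\ @integer_lattice R m y.
Proof.
split=> [h|[tZ yZ] i].
  split=> [|i]; first by have := h (lshift m 0); rewrite row_mxEl mxE eqxx mulr1n.
  by have := h (rshift 1 i); rewrite row_mxEr.
case: (split_ordP i) => j ->; last by rewrite row_mxEr.
by rewrite row_mxEl mxE (ord1 j) eqxx mulr1n.
Qed.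

(** Serves for all lattice points, with c = d + 1, and for the interior ones, with c = d - 1 and the
    start shifted by 1. *)
Lemma segment_points_card a c k (A : set 'rV[R]_m) : A #= `I_k ->
  [set x : 'rV[R]_(1 + m) | (exists2 i : 'I_c, lsubmx x 0 0 = (a + i%:Z)%:~R & A (rsubmx x))]
    #= `I_(c * k).
Proof.
move=> /card_range[f fI ->].
pose g (p : 'I_c * 'I_k) : 'rV[R]_(1 + m) := row_mx ((a + p.1%:Z)%:~R)%:M (f p.2).
have gI : injective g.
  move=> [i1 j1] [i2 j2] /row_mx1_inj[/= /intr_inj /addrI [i12] /fI ->].
  by congr (_, _); exact: val_inj.
have := range_card gI; rewrite card_prod !card_ord; congr (_ #= _).
apply/seteqP; split => x /=.
  move=> [[i j] _ <-]; exists i; last by rewrite row_mxKr; exists j.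
  by rewrite row_mx1Kl.
by move=> [i h [j _ hj]]; exists (i, j) => //; rewrite (row_mx1E x) h -hj.
Qed.

Lemma segment_prod_lattice a d P :
  segment_prod a d P `&` @integer_lattice R _ =
  [set x | exists2 i : 'I_d.+1, lsubmx x 0 0 = (a + i%:Z)%:~R &
     (P `&` @integer_lattice R _) (rsubmx x)].
Proof.
apply/seteqP; split=> x; rewrite (row_mx1E x) /setI /= row_mx1Kl row_mxKr
  segment_prod_row row_mx_lattice; move: (lsubmx x 0 0) (rsubmx x) => t y.
  move=> [[h Py] [/intrP[z tz] yZ]]; move: h; rewrite tz.
  rewrite [d%:R]pmulrn -intrD !ler_int => /andP[h1 h2].
  have zd : (`|(z - a)%R| < d.+1)%N by lia.
  by exists (Ordinal zd) => //=; apply/eqP; rewrite eqr_int; lia.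
move=> [i -> [Py yZ]]; split; last by split => //; exact: intr_int.
split => //.
by rewrite [d%:R]pmulrn -intrD !ler_int; have := ltn_ord i; lia.
Qed.

Lemma segment_prod_interior_lattice a d P : (0 < d)%N ->
  (segment_prod a d P)° `&` @integer_lattice R _ =
  [set x | exists2 i : 'I_d.-1, lsubmx x 0 0 = (a + 1 + i%:Z)%:~R &
     (P° `&` @integer_lattice R _) (rsubmx x)].
Proof.
move=> d0; apply/seteqP; split=> x; rewrite (row_mx1E x) /setI /=
  segment_prod_interior row_mx1Kl row_mxKr row_mx_lattice;
  move: (lsubmx x 0 0) (rsubmx x) => t y.
  move=> [[h Py] [/intrP[z tz] yZ]]; move: h; rewrite tz.
  rewrite [d%:R]pmulrn -intrD !ltr_int => /andP[h1 h2].
  have zd : (`|(z - a - 1)%R| < d.-1)%N by lia.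
  by exists (Ordinal zd) => //=; apply/eqP; rewrite eqr_int; lia.
move=> [i -> [Py yZ]]; split; last by split => //; exact: intr_int.
split => //.
by rewrite [d%:R]pmulrn -intrD !ltr_int; have := ltn_ord i; lia.
Qed.

Lemma dilate_segment_prod k a d P : (0 < k)%N ->
  dilate k (segment_prod a d P) = segment_prod (k%:Z * a) (k * d) (dilate k P).
Proof.
move=> k0; have kR : 0 < k%:R :> R by rewrite ltr0n.
apply/seteqP; split => x.
  move=> [y + <-]; rewrite (row_mx1E y) scale_row_mx scale_scalar_mx !segment_prod_row.
  move: (lsubmx y 0 0) (rsubmx y) => t z [h Pz]; split; last by exists z.
  by rewrite intrM natrM -mulrDr !ler_pM2l.
rewrite (row_mx1E x) segment_prod_row; move: (lsubmx x 0 0) (rsubmx x) => t _ [h [z Pz <-]].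
exists (row_mx (k%:R^-1 * t)%:M z).
  apply/segment_prod_row; split => //; move: h.
  by rewrite intrM natrM -mulrDr !ler_pdivlMl ?ler_pdivrMl.
by rewrite scale_row_mx scale_scalar_mx mulrA mulfV ?gt_eqF// mul1r.
Qed.

Lemma segment_prod_polytope a d l P : (0 < d)%N ->
  polytopes_with_interior_points l P ->
  polytopes_with_interior_points (d.-1 * l) (segment_prod a d P).
Proof.
move=> d0 [/lattice_polytopeP[s [PE sZ [x Px]]] Pl]; split; last first.
  by rewrite segment_prod_interior_lattice//; exact: segment_points_card.
have dR : 0 < d%:R :> R by rewrite ltr0n.
apply/lattice_polytopeP; eexists; split; first by rewrite PE segment_prod_hull.
  move=> y /=; rewrite mem_cat => /orP[] /mapP[z zs ->]; apply/row_mx_lattice.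
    by split; [exact: intr_int|exact: sZ].
  by split; [rewrite rpredD ?intr_int// natr_int|exact: sZ].
exists (row_mx (a%:~R + d%:R / 2)%:M x); apply/segment_prod_interior.
rewrite row_mx1Kl row_mxKr; split => //.
by apply/andP; split; lra.
Qed.

Lemma segment_prod_counts a d P (G : {poly R[i]}) :
  counts_lattice_points P G ->
  counts_lattice_points (segment_prod a d P) (G * (d%:R *: 'X + 1)).
Proof.
move=> cG k k0; have [c cP Gk] := cG k k0.
exists ((k * d).+1 * c)%N.
  by rewrite dilate_segment_prod// segment_prod_lattice; exact: segment_points_card.
by rewrite hornerM hornerD hornerZ hornerX hornerC Gk natrM mulrC -natr1 natrM [d%:R * _]mulrC.
Qed.

Lemma segment_prod_symmetric d P : P = -%R @` P ->
  segment_prod (- d%:Z) (d + d) P = -%R @` segment_prod (- d%:Z) (d + d) P.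
Proof.
move=> Ps; have PN (z : 'rV[R]_m) : P z -> P (- z) by move=> Pz; rewrite Ps; exists z.
have sub x : segment_prod (- d%:Z) (d + d) P x -> segment_prod (- d%:Z) (d + d) P (- x).
  rewrite (row_mx1E x) opp_row_mx -raddfN !segment_prod_row.
  move: (lsubmx x 0 0) (rsubmx x) => t y [h /PN Py]; split => //.
  by move: h; rewrite natrD rmorphN /= => /andP[h1 h2]; apply/andP; split; lra.
apply/seteqP; split => x; last by move=> [y /sub ? <-].
by move=> /sub h; exists (- x); rewrite ?opprK.
Qed.

End SegmentProduct.

(** * Polynomials with nonnegative values at the positive integers *)

Section ComplexPolynomials.
Variable R : realType.
Local Notation C := R[i].
Implicit Types (p q : {poly C}) (n k : nat).

Lemma complex_ge0P (z : C) : 0 <= z -> exists2 x : R, 0 <= x & z = (x%:C)%C.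
Proof. by case: z => a b; rewrite lecE /= => /andP[/eqP -> a0]; exists a. Qed.

Lemma complex_archimedean_eq0 (d c : C) : 0 <= d -> 0 <= c ->
  (forall k, (0 < k)%N -> k%:R * d <= c) -> d = 0.
Proof.
move=> /complex_ge0P[x x0 ->] /complex_ge0P[y y0 ->] h.
have [->//|xn0] := eqVneq x 0.
have xp : 0 < x by rewrite lt_neqAle eq_sym xn0.
have := h (Num.bound (y / x)); rewrite -(rmorph_nat (real_complex R)) -rmorphM /= lecR.
rewrite -ler_pdivlMr// => {}h.
have yx : 0 <= y / x by rewrite divr_ge0.
by have := archi_boundP yx; rewrite ltNge h//.
Qed.

Lemma poly_nat_eq0 p : (forall k, (0 < k)%N -> p.[k%:R] = 0) -> p = 0.
Proof.
move=> h; apply/eqP; apply/negP => /negP p0.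
pose s : seq C := [seq k%:R | k <- iota 1 (size p)].
have rs : all (root p) s.
  by apply/allP => z /mapP[k]; rewrite mem_iota => /andP[k0 _] ->; apply/eqP/h.
have us : uniq s.
  rewrite map_inj_uniq ?iota_uniq// => i j /eqP.
  by rewrite eqr_nat => /eqP.
by have := max_poly_roots p0 rs us; rewrite size_map size_iota ltnn.
Qed.

(** The values p(k) / k^n are nonnegative and within S / k of the coefficient. Hence k times the
    difference of its norm and itself stays bounded, and that difference is 0. *)
Lemma coef_ge0 p n : (size p <= n.+1)%N ->
  (forall k, (0 < k)%N -> 0 <= p.[k%:R]) -> 0 <= p`_n.
Proof.
move=> sp h; pose S := \sum_(i < n) `|p`_i|.
have key k : (0 < k)%N -> k%:R * `|p`_n - p.[k%:R] / k%:R ^+ n| <= S.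
  move=> k0; have kC : 0 < k%:R :> C by rewrite ltr0n.
  have k1 : 1 <= k%:R :> C by rewrite ler1n.
  rewrite (horner_coef_wide _ sp) big_ord_recr /= mulrDl mulfK ?expf_neq0 ?gt_eqF//.
  rewrite opprD addrCA subrr addr0 normrN normrM normfV normrX (gtr0_norm kC).
  rewrite mulrA ler_pdivrMr ?exprn_gt0// mulrC.
  case: n {sp h} @S => [|n] S.
    by rewrite big_ord0 normr0 mul0r mulr_ge0// sumr_ge0.
  rewrite exprSr mulrA ler_pM2r//.
  apply: le_trans (ler_norm_sum _ _ _) _; rewrite mulr_suml ler_sum// => i _.
  rewrite normrM normrX (gtr0_norm kC) ler_wpM2l//.
  by rewrite ler_weXn2l// -ltnS.
suff /eqP : `| `|p`_n| - p`_n | = 0 by rewrite normr_eq0 subr_eq0 => /eqP <-.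
apply: (complex_archimedean_eq0 (c := S + S)) => //.
  by rewrite addr_ge0// sumr_ge0.
move=> k k0; have := key k k0; set r := _ / _ => hr.
have r0 : 0 <= r by rewrite divr_ge0 ?exprn_ge0 ?h.
apply: le_trans (lerD hr hr); rewrite -mulrDr ler_wpM2l//.
have -> : `|p`_n| - p`_n = (`|p`_n| - r) + (r - p`_n) by rewrite addrA subrK.
apply: le_trans (ler_normD _ _) _; rewrite (distrC r) lerD2r.
by rewrite -{1}(ger0_norm r0) ler_dist_dist.
Qed.

(** If the degree d of p exceeded n, the coefficients of index d of p and of q - p would be opposite
    and both nonnegative, so the leading coefficient of p would vanish. *)
Lemma size_le_of_bound p q n : (size q <= n.+1)%N ->
  (forall k, (0 < k)%N -> 0 <= p.[k%:R] <= q.[k%:R]) -> (size p <= n.+1)%N.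
Proof.
move=> sq h; rewrite leqNgt; apply/negP => sp.
have sp1 : size p = (size p).-1.+1 by rewrite prednK// (leq_ltn_trans _ sp).
set d := (size p).-1 in sp1.
have nd : (n.+1 <= d)%N by rewrite -ltnS -sp1.
have hp : 0 <= p`_d by apply: coef_ge0 => [|k /h/andP[]//]; rewrite sp1.
have : 0 <= (q - p)`_d.
  apply: coef_ge0 => [|k /h/andP[_]]; last by rewrite hornerD hornerN subr_ge0.
  rewrite (leq_trans (size_polyD _ _))// geq_max size_polyN -sp1 leqnn andbT sp1.
  by rewrite (leq_trans sq)// (leq_trans nd).
rewrite coefB (_ : q`_d = 0); last by rewrite nth_default// (leq_trans sq).
rewrite add0r oppr_ge0 => pn.
have /eqP : p`_d = 0 by apply/eqP; rewrite eq_le hp pn.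
by rewrite -/(lead_coef p) lead_coef_eq0 => /eqP p0; rewrite p0 size_poly0 in sp.
Qed.

Lemma prod_linear n (c : 'I_n -> C) (p := \prod_i (1 + c i *: 'X)) :
  (size p <= n.+1)%N /\ p`_n = \prod_i c i.
Proof.
rewrite {}/p; elim: n c => [|n IH] c; first by rewrite !big_ord0 size_poly1 coefC.
have [IHs IHc] := IH (fun i => c (widen_ord (leqnSn n) i)).
rewrite !big_ord_recr /=; move: IHs IHc; set p := \prod_(i < n) _ => IHs IHc.
have s2 : (size (1 + c ord_max *: 'X : {poly C})%R <= 2)%N.
  rewrite (leq_trans (size_polyD _ _))// geq_max size_poly1 /=.
  by rewrite (leq_trans (size_scale_leq _ _))// size_polyX.
split.
  rewrite (leq_trans (size_polyMleq _ _))//.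
  by move: (size _) (size _) s2 IHs => a d; lia.
rewrite mulrDr mulr1 coefD -scalerAr coefZ coefMX /= IHc mulrC.
by rewrite nth_default// add0r.
Qed.

End ComplexPolynomials.

(** * Uniqueness of the counting polynomial *)

Section Ehrhart.
Variables (R : realType) (n : nat).
Implicit Types (P : set 'rV[R]_n) (G : {poly R[i]}).

Lemma ehrhartE P G : counts_lattice_points P G -> ehrhart P = G.
Proof.
move=> cG; apply: xget_unique => // H cH.
apply/eqP; rewrite -subr_eq0; apply/eqP/poly_nat_eq0 => k k0.
have [a Pa Ga] := cG k k0; have [b Pb Hb] := cH k k0.
rewrite hornerD hornerN Ga Hb (_ : a = b) ?subrr//.
by apply/card_eq_II; apply: card_eq_trans Pb; rewrite card_eq_sym.
Qed.

(** The choice returns a counting polynomial or the default [1]. The default has no root, so in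
    [GammaP] a root certifies a counting polynomial. *)
Lemma ehrhart_counts P : ehrhart P <> 1 -> counts_lattice_points P (ehrhart P).
Proof. by rewrite /ehrhart; case: xgetP. Qed.

Lemma GammaP l (s : R[i]) : Gamma R n l s <->
  exists P G, [/\ polytopes_with_interior_points l P, counts_lattice_points P G & root G s].
Proof.
split=> [[P Pl rs]|[P [G [Pl /ehrhartE <- rs]]]]; last by exists P.
exists P, (ehrhart P); split => //; apply: ehrhart_counts => P1.
by move: rs; rewrite P1 rootC oner_eq0.
Qed.

End Ehrhart.

(** Length d = 1 leaves no interior lattice point, as used in (i); d = 2 preserves l, as used in
    (ii). *)
Lemma Gamma_segment_prod (R : realType) (m l d : nat) : (0 < d)%N ->
  Gamma R m l `<=` Gamma R m.+1 (d.-1 * l).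
Proof.
move=> d0 s /GammaP[P [G [Pl cG rs]]]; apply/GammaP.
exists (segment_prod 0 d P), (G * (d%:R *: 'X + 1)); split.
- exact: segment_prod_polytope.
- exact: segment_prod_counts.
- by rewrite rootM rs.
Qed.

(** * Cluster points *)

Section ClusterPoints.
Variable R : realType.
Implicit Types (A B : set R[i]) (z : R[i]).

Lemma cluster_point_sub A B z : A `<=` B -> cluster_point A z -> cluster_point B z.
Proof.
move=> AB Az U Uz /(sub_finite_set (A := U `&` A)) h; apply: (Az U Uz); apply: h.
exact: setIS.
Qed.

Lemma cluster_point_infinite A z : cluster_point A z -> infinite_set A.
Proof. by move=> /(_ setT filterT); rewrite setTI. Qed.

(** If [U] met [A] in finitely many points, deleting those other than z would leave a neighbourhood
    of z, finite sets being closed, and it would contain no approximating point. *)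
Lemma cluster_point_lim A z :
  (forall e : R, 0 < e -> exists2 a, A a /\ a != z & `|a - z| < (e%:C)%C) ->
  cluster_point A z.
Proof.
move=> h U Uz finUA.
have finF : finite_set ((U `&` A) `\ z) by exact: finite_setD.
have cF : closed ((U `&` A) `\ z : set (R[i])^o).
  have acc : accessible_space (R[i])^o by apply: hausdorff_accessible; exact: norm_hausdorff.
  exact: (accessible_finite_set_closed.1 acc).
have : nbhs (z : (R[i])^o) (U `&` ~` ((U `&` A) `\ z)).
  apply: filterI => //; apply: open_nbhs_nbhs; split; first exact: closed_openC.
  by move=> [_ /(_ erefl)].
move=> /nbhs_ballP[d /= d0 hd].
have [x x0 xd] := complex_ge0P (ltW d0).
have xp : 0 < x by rewrite -ltcR -xd.
have [a [Aa az] adist] := h x xp.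
have [] := hd a; first by rewrite -ball_normE /= distrC xd.
by move=> Ua; apply; split => //; apply/eqP.
Qed.

End ClusterPoints.

(** * Boxes, and the cluster point 0 *)

Section Boxes.
Variable R : realType.

Lemma point_polytope : symmetric_polytopes_with_interior_points 1 [set: 'rV[R]_0].
Proof.
have all0 (x : 'rV[R]_0) : x = 0 by apply/rowP => -[].
have card1 : [set: 'rV[R]_0] #= `I_1.
  rewrite (_ : [set: _] = [set 0]); first exact: card_set1.
  by apply/seteqP; split => // x _; exact: all0.
have ZT : @integer_lattice R 0 = setT by apply/seteqP; split => // x _ [].
split; last by apply/seteqP; split => // x _; exists 0; rewrite // oppr0 [RHS]all0.
split; last by rewrite interiorT ZT setTI.
apply/lattice_polytopeP; exists [:: 0]; split.
- apply/seteqP; split => // x _; apply: sub_convex_hull.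
  by rewrite /= inE; apply/eqP; exact: all0.
- by rewrite ZT.
- by exists 0; rewrite interiorT.
Qed.

Lemma point_counts : counts_lattice_points [set: 'rV[R]_0] 1.
Proof.
move=> k k0; exists 1%N; last by rewrite hornerC.
have all0 (x : 'rV[R]_0) : x = 0 by apply/rowP => -[].
rewrite (_ : _ `&` _ = [set 0]); first exact: card_set1.
apply/seteqP; split => x _; first exact: all0.
by split => [|[]//]; exists x => //; rewrite [RHS]all0 [LHS]all0.
Qed.

(** The cube [-1, 1]^n, built one coordinate at a time from a point. *)
Lemma cube n : exists2 P : set 'rV[R]_n, symmetric_polytopes_with_interior_points 1 P &
  counts_lattice_points P ((2 *: 'X + 1) ^+ n).
Proof.
elim: n => [|n [P [Pl Ps] cP]].
  by exists setT; [exact: point_polytope|rewrite expr0; exact: point_counts].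
exists (segment_prod (- 1%:Z) (1 + 1) P).
  split; last exact: segment_prod_symmetric.
  exact: (@segment_prod_polytope R n (- 1%:Z) 2 1 P isT Pl).
by rewrite exprSr; exact: (@segment_prod_counts R n (- 1%:Z) 2 P _ cP).
Qed.

(** The box [-h, h] x [-1, 1]^n, whose interior lattice points all lie on the first axis. *)
Lemma box n h : (0 < h)%N ->
  exists2 P : set 'rV[R]_n.+1, symmetric_polytopes_with_interior_points (h + h).-1 P &
    counts_lattice_points P ((2 *: 'X + 1) ^+ n * ((h + h)%:R *: 'X + 1)).
Proof.
move=> h0; have [P [Pl Ps] cP] := cube n.
have hh : (0 < h + h)%N by rewrite addn_gt0 h0.
exists (segment_prod (- h%:Z) (h + h) P); last exact: segment_prod_counts.
split; last exact: segment_prod_symmetric.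
by have := segment_prod_polytope (- h%:Z) hh Pl; rewrite muln1.
Qed.

Lemma Gamma0_mono m n : (m <= n)%N -> Gamma R m 0 `<=` Gamma R n 0.
Proof.
elim: n => [|n IH]; first by rewrite leqn0 => /eqP ->.
rewrite leq_eqVlt => /predU1P[->//|/IH mn]; apply: subset_trans mn _.
exact: (@Gamma_segment_prod R n 0 1).
Qed.

(** The rectangle [0, 1] x [0, m] has no interior lattice point, and its counting polynomial has the
    factor m X + 1. *)
Lemma Gamma0_invn m n : (2 <= n)%N -> (0 < m)%N -> Gamma R n 0 (- m%:R^-1).
Proof.
move=> n2 m0; apply: (Gamma0_mono n2); apply: (@Gamma_segment_prod R 1 m.-1 1) => //.
apply/GammaP; exists (segment_prod 0 m setT), (1 * (m%:R *: 'X + 1)); split.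
- by rewrite -[m.-1]muln1; apply: segment_prod_polytope => //; case: point_polytope.
- by apply: segment_prod_counts; exact: point_counts.
- rewrite mul1r; apply/eqP; rewrite hornerD hornerZ hornerX hornerC mulrN mulfV ?addNr//.
  by rewrite pnatr_eq0 -lt0n.
Qed.

Lemma cluster_point0 n : (2 <= n)%N -> cluster_point (Gamma R n 0) 0.
Proof.
move=> n2; apply: cluster_point_lim => e e0.
have ei0 : 0 <= e^-1 by rewrite invr_ge0 ltW.
have m0 : (0 < (Num.bound e^-1).+1)%N by [].
exists (- (Num.bound e^-1).+1%:R^-1); first split.
- exact: Gamma0_invn.
- by rewrite oppr_eq0 invr_eq0 pnatr_eq0.
rewrite subr0 normrN ger0_norm ?invr_ge0//.
rewrite -(rmorph_nat (real_complex R)) -fmorphV /= ltcR invf_plt ?posrE//.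
by rewrite (lt_trans (archi_boundP ei0))// ltr_nat.
Qed.

End Boxes.

(** * The extremal boxes for (iii) *)

Section Roots.
Variable R : realType.

Lemma half_rootC n (x : R[i]) : (0 < n)%N -> 2^-1 * n.-root x = n.-root (2^-1 ^+ n * x).
Proof.
by move=> n0; rewrite rootCMl ?exprn_ge0 ?invr_ge0// exprCK ?invr_ge0.
Qed.

(** The box [-h, h] x [-1, 1]^(n-1) with 2 h = l + 1: one [gamma] is 1 / (l + 1), the others are 1 /
    2. *)
Lemma tight_example n l : (1 <= n)%N -> odd l ->
  exists P : set 'rV[R]_n, symmetric_polytopes_with_interior_points l P /\
  exists gamma : 'I_n -> R[i], ehrhart_factorization P gamma /\
    2^-1 * n.-root (2 / l.+1%:R) = n.-root (\prod_(i < n) gamma i).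
Proof.
case: n => // n _ ol.
have [h h0 lh] : exists2 h, (0 < h)%N & l = (h + h).-1.
  by exists l.+1./2; [by case: (l) ol|rewrite addnn; lia].
have [P Pl cP] := box R n h0; exists P; rewrite lh; split => //.
have hC : (h + h)%:R != 0 :> R[i] by rewrite pnatr_eq0 -lt0n addn_gt0 h0.
exists (fun i => if i == ord0 then (h + h)%:R^-1 else 2^-1); split.
  split; first by move=> i; case: ifP => _; rewrite invr_eq0 ?hC ?pnatr_eq0.
  rewrite (ehrhartE cP) big_ord_recl /= invrK mulrC addrC; congr (_ * _).
  by rewrite prodr_const card_ord invrK addrC.
rewrite half_rootC// big_ord_recl /=.
rewrite prodr_const card_ord prednK ?addn_gt0 ?h0//; congr (_.-root _).
by rewrite exprS mulrACA mulVf ?pnatr_eq0// mul1r mulrC.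
Qed.

End Roots.

(** * Column heights of a tetrahedron summed over a square *)

Section TentSums.

Lemma sum_subn_double i k : (i <= k)%N -> ((\sum_(j < k.+1) (i - j)) * 2 = i * i.+1)%N.
Proof.
elim: i k => [|i IH] [|k]// ik; first by rewrite big1.
  by rewrite big1// => j _; rewrite sub0n.
rewrite big_ord_recl subn0 mulnDl (eq_bigr (fun j : 'I_k.+1 => (i - j)%N)) => [|j _].
  by rewrite IH//; nia.
by rewrite lift0 subSS.
Qed.

(** The truncated [i + j - k] is max(0, i + j - k). Reversing j turns its sum into that of [i - j],
    and [minn i j + (i - j)] is i. *)
Lemma sum_tent_row i k : (i <= k)%N ->
  (\sum_(j < k.+1) (minn i j - (i + j - k)) = i * (k - i))%N.
Proof.
move=> ik.
have h1 : (\sum_(j < k.+1) (minn i j - (i + j - k)) + \sum_(j < k.+1) (i + j - k) =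
    \sum_(j < k.+1) minn i j)%N.
  by rewrite -big_split; apply: eq_bigr => j _ /=; have := ltn_ord j; lia.
have h2 : (\sum_(j < k.+1) (i + j - k) = \sum_(j < k.+1) (i - j))%N.
  rewrite (reindex_inj rev_ord_inj); apply: eq_bigr => j _ /=.
  by have := ltn_ord j; lia.
have h3 : (\sum_(j < k.+1) minn i j + \sum_(j < k.+1) (i - j) = k.+1 * i)%N.
  rewrite -big_split /= (eq_bigr (fun=> i)) => [|j _]; last by lia.
  by rewrite sum_nat_const card_ord.
have := sum_subn_double ik; nia.
Qed.

Lemma sum_tent (A : comRingType) k :
  (\sum_(i < k.+1) \sum_(j < k.+1) (minn i j - (i + j - k)))%N%:R * 6 =
  k%:R ^+ 3 - k%:R :> A.
Proof.
have E m : (m <= k.+1)%N -> (\sum_(i < m) i * (k - i))%N%:R * 6 =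
    3 * k%:R * m%:R * (m%:R - 1) - (m%:R - 1) * m%:R * (2 * m%:R - 1) :> A.
  elim: m => [|m IH] mk; first by rewrite big_ord0; ring.
  by rewrite big_ord_recr /= natrD mulrDl IH ?(ltnW mk)// natrM natrB// -natr1; ring.
rewrite (eq_bigr (fun i : 'I_k.+1 => (i * (k - i))%N)) => [|i _].
  by rewrite E// -natr1; ring.
by apply: sum_tent_row; rewrite -ltnS.
Qed.

End TentSums.

(** * Reeve's tetrahedra of height 6 q *)

Section Reeve.
Variables (R : realType) (q : nat).
Hypothesis q0 : (0 < q)%N.
Local Notation r := (6 * q)%N.
Implicit Types (x y : 'rV[R]_3) (k : nat).

Let vec3 (a b c : R) : 'rV[R]_3 := \row_i [:: a; b; c]`_i.

Lemma vec3E a b c : (vec3 a b c 0 0 = a) * (vec3 a b c 0 1 = b) * (vec3 a b c 0 2 = c).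
Proof. by rewrite !mxE. Qed.

Lemma forall_ord3 (Q : 'I_3 -> Prop) : Q 0 -> Q 1 -> Q 2 -> forall i, Q i.
Proof.
move=> Q0 Q1 Q2 [[|[|[|//]]] h].
- by rewrite (_ : Ordinal h = 0)//; exact: val_inj.
- by rewrite (_ : Ordinal h = 1)//; exact: val_inj.
- by rewrite (_ : Ordinal h = 2)//; exact: val_inj.
Qed.

Lemma vec3_eta x : x = vec3 (x 0 0) (x 0 1) (x 0 2).
Proof. by apply/rowP; apply: forall_ord3; rewrite vec3E. Qed.

(* The facets of Reeve's tetrahedron, dilated by [k]. *)
Definition in_reeve (k : R) (a b c : R) : Prop :=
  [/\ 0 <= c, c <= r%:R * a, c <= r%:R * b & r%:R * (a + b) - c <= r%:R * k].

Definition reeve_vertices : seq 'rV[R]_3 :=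
  [:: vec3 0 0 0; vec3 1 0 0; vec3 0 1 0; vec3 1 1 r%:R].

Definition reeve : set 'rV[R]_3 := convex_hull [set` reeve_vertices].

Let r0 : 0 < r%:R :> R. Proof. by rewrite ltr0n muln_gt0. Qed.

Lemma reeveP x : reeve x <-> in_reeve 1 (x 0 0) (x 0 1) (x 0 2).
Proof.
split.
  apply: (@convex_hull_sub _ _ _ [set x | in_reeve 1 (x 0 0) (x 0 1) (x 0 2)]).
    apply/convex_setE => {}x y s t s0 t0 st [h1 h2 h3 h4] [k1 k2 k3 k4] /=.
    rewrite !mxE /in_reeve; move: r%:R h2 h3 h4 k2 k3 k4 => u h2 h3 h4 k2 k3 k4.
    have -> : t = 1 - s by rewrite -st addrAC subrr add0r.
    have t0' : 0 <= 1 - s by rewrite -st addrAC subrr add0r.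
    split.
    - have := ler_wpM2l s0 h1; have := ler_wpM2l t0' k1; lra.
    - have := ler_wpM2l s0 h2; have := ler_wpM2l t0' k2; lra.
    - have := ler_wpM2l s0 h3; have := ler_wpM2l t0' k3; lra.
    - have := ler_wpM2l s0 h4; have := ler_wpM2l t0' k4; lra.
  move=> z /=; rewrite !inE => /or4P[] /eqP ->; rewrite !vec3E; split;
    rewrite ?mulr0 ?mulr1; move: r0; move: r%:R => u u0; lra.
rewrite (vec3_eta x) !vec3E; move: (x 0 0) (x 0 1) (x 0 2) => a b c {x} [h1 h2 h3 h4].
(* The barycentric coordinates are 1 - (a + b - w), a - w, b - w and w; the facet inequalities say
   that they are nonnegative. *)
pose w := c / r%:R; have cw : c = r%:R * w by rewrite /w mulrCA mulfV ?mulr1// gt_eqF.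
clearbody w; rewrite cw {c cw} in h1 h2 h3 h4 *.
have w0 : 0 <= w by rewrite -(pmulr_rge0 _ r0).
have aw : 0 <= a - w by rewrite subr_ge0 -(ler_pM2l r0).
have bw : 0 <= b - w by rewrite subr_ge0 -(ler_pM2l r0).
have abw : 0 <= 1 - (a + b - w) by rewrite subr_ge0 -(ler_pM2l r0) mulrBr.
apply/cone_over1.
have -> : vec3 a b (r%:R * w) = (1 - (a + b - w)) *: vec3 0 0 0 +
   ((a - w) *: vec3 1 0 0 + ((b - w) *: vec3 0 1 0 + w *: vec3 1 1 r%:R)).
  by apply/rowP; apply: forall_ord3; rewrite !mxE /=; ring.
have E : (1 - (a + b - w)) + ((a - w) + ((b - w) + w)) = 1 by ring.
rewrite -[X in cone_over _ X _]E {E}.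
have cv : @convex_set R 'rV[R]_3 reeve by exact: convex_hull_convex.
have vR v : v \in reeve_vertices -> reeve v by exact: sub_convex_hull.
apply: cone_overD => //; first by apply: cone_over_mem => //; apply: vR; rewrite !inE eqxx.
apply: cone_overD => //; first by apply: cone_over_mem => //; apply: vR; rewrite !inE eqxx orbT.
apply: cone_overD => //; first by apply: cone_over_mem => //; apply: vR; rewrite !inE eqxx !orbT.
by apply: cone_over_mem => //; apply: vR; rewrite !inE eqxx !orbT.
Qed.

Lemma dilate_reeveP k x : (0 < k)%N ->
  dilate k reeve x <-> in_reeve k%:R (x 0 0) (x 0 1) (x 0 2).
Proof.
move=> k0; have kR : 0 < k%:R :> R by rewrite ltr0n.
split=> [[y /reeveP[h1 h2 h3 h4] <-]|[h1 h2 h3 h4]].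
  rewrite !mxE; split.
  - exact: mulr_ge0.
  - by rewrite mulrCA ler_pM2l.
  - by rewrite mulrCA ler_pM2l.
  - by rewrite -mulrDr mulrCA -mulrBr [leRHS]mulrC ler_pM2l// -[r%:R in leRHS]mulr1.
exists (k%:R^-1 *: x); last by rewrite scalerA mulfV ?gt_eqF// scale1r.
apply/reeveP; rewrite !mxE; split.
- by rewrite mulr_ge0// invr_ge0.
- by rewrite mulrCA ler_pM2l// invr_gt0.
- by rewrite mulrCA ler_pM2l// invr_gt0.
- by rewrite -mulrDr mulrCA -mulrBr ler_pdivrMl// mulr1 [k%:R * _]mulrC.
Qed.

(** As r = 6 q, the column heights over the square sum to q (k^3 - k); each of the (k + 1)^2 columns
    holds one point more than its height. *)
Lemma reeve_counts :
  counts_lattice_points reeve (q%:R *: ('X^3 - 'X) + ('X + 1) ^+ 2 : {poly R[i]}).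
Proof.
move=> k k0.
(* Above the point (i, j) of the square [0, k]^2, the last coordinate runs from
   r max(0, i + j - k) to r min(i, j). *)
pose lo (p : 'I_k.+1 * 'I_k.+1) := (p.1 + p.2 - k)%N.
pose N (p : 'I_k.+1 * 'I_k.+1) := (r * (minn p.1 p.2 - lo p)).+1.
pose f (u : {p & 'I_(N p)}) : 'rV[R]_3 :=
  vec3 (tag u).1%:R (tag u).2%:R (r * lo (tag u) + tagged u)%:R.
have fI : injective f.
  move=> [p t] [p' t'] /rowP e.
  have := e 0; have := e 1; have := e 2; rewrite !vec3E /= => e2 e1 e0.
  have {e0 e1} pp : p = p'.
    case: p p' {t t' e e2} e0 e1 => [i j] [i' j'] /= /eqP e0 /eqP e1.
    move: e0 e1; rewrite !eqr_nat => /eqP e0 /eqP e1.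
    by congr (_, _); exact: val_inj.
  subst p'; congr existT; apply: val_inj; move/eqP: e2.
  by rewrite eqr_nat eqn_add2l => /eqP.
exists #|{: {p & 'I_(N p)}}|.
  have := range_card fI; congr (_ #= _); apply/seteqP; split => x.
    move=> [[[i j] t] _ <-]; split.
      apply/dilate_reeveP => //; rewrite !vec3E /=.
      have := ltn_ord t; rewrite /N /lo /= => ht.
      have := ltn_ord i; have := ltn_ord j => hj hi.
      split; first by rewrite ler0n.
      - rewrite -natrM ler_nat; nia.
      - rewrite -natrM ler_nat; nia.
      - rewrite lerBlDr -natrD -!natrM -natrD ler_nat; nia.
    by apply: forall_ord3; rewrite vec3E natr_int.
  move=> [/dilate_reeveP - /(_ k0)] + xZ; rewrite (vec3_eta x) !vec3E.
  have := xZ 0; have := xZ 1; have := xZ 2.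
  move: (x 0 0) (x 0 1) (x 0 2) => a b c {xZ} /intrP[z ->] /intrP[j ->] /intrP[i ->] [].
  rewrite [r%:R]pmulrn [k%:R]pmulrn -intrD -!intrM -intrB !ler_int (ler_int _ 0).
  move=> h1 h2 h3 h4.
  have [i0 j0] : (0 <= i /\ 0 <= j)%R by split; nia.
  have [ik jk] : (i <= k%:Z /\ j <= k%:Z)%R by split; nia.
  have ik' : (`|i| < k.+1)%N by lia.
  have jk' : (`|j| < k.+1)%N by lia.
  have zt : (`|z| - r * (`|i| + `|j| - k) < N (Ordinal ik', Ordinal jk'))%N.
    rewrite /N /lo /=.
    have : (`|z| <= r * `|i|)%N by lia.
    have : (`|z| <= r * `|j|)%N by lia.
    move: (6 * q)%N => u hu1 hu2; nia.
  exists (existT (fun p => 'I_(N p)) (Ordinal ik', Ordinal jk') (Ordinal zt)) => //.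
  rewrite /f /= /lo /=; congr vec3; rewrite pmulrn; congr (_%:~R); lia.
rewrite card_tagged sumnE big_map big_enum /=.
under eq_bigr do rewrite card_ord.
rewrite /N /lo; under eq_bigr do rewrite -addn1.
rewrite big_split /= sum1_card card_prod !card_ord -big_distrr /=.
rewrite -(pair_bigA _ (fun i j : 'I_k.+1 => (minn i j - (i + j - k)))%N) /=.
rewrite natrD 3!natrM [6 * _]mulrC -[q%:R * 6 * _]mulrA [6 * _]mulrC sum_tent.
rewrite !(hornerE, hornerXn) -natr1; ring.
Qed.

(** An interior lattice point (i, j, z) would satisfy r (i + j - 1) < z < r i, so j < 1, and 0 < z <
    r j, so j > 0. *)
Lemma reeve_polytope : polytopes_with_interior_points 0 reeve.
Proof.
split.
  apply/lattice_polytopeP; exists reeve_vertices; split => //.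
    move=> x /=; rewrite !inE => /or4P[] /eqP ->; apply: forall_ord3;
      by rewrite vec3E ?natr_int// ?int_num0 ?int_num1.
  (* At the centroid each facet inequality has slack r / 4, while moving all coordinates by less
     than 1/24 costs at most (2 r + 1) / 24, which is smaller as r >= 1. *)
  exists (vec3 2^-1 2^-1 (r%:R / 4)); apply/interior_boxP.
  exists (24^-1); first by rewrite invr_gt0.
  move=> y h; apply/reeveP.
  have := h 0; have := h 1; have := h 2; rewrite !vec3E.
  rewrite /in_reeve.
  have r1 : 1 <= r%:R :> R by rewrite ler1n muln_gt0.
  move: r%:R r1 (y 0 0) (y 0 1) (y 0 2) => u u1 a b c.
  rewrite !ltr_norml => /andP[c1 c2] /andP[b1 b2] /andP[a1 a2].
  by split; nra.
rewrite (_ : _ `&` _ = set0); first by rewrite (_ : `I_0 = set0)// -subset0 => ?.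
apply/seteqP; split => // x [/interior_boxP[e e0 eP] xZ].
have := xZ 0; have := xZ 1; have := xZ 2 => /intrP[z hz] /intrP[j hj] /intrP[i hi].
have e2 : 0 < e / 2 by rewrite divr_gt0.
have near a b c : `|a| <= e / 2 -> `|b| <= e / 2 -> `|c| <= e / 2 ->
    in_reeve 1 (i%:~R - a) (j%:~R - b) (z%:~R - c).
  move=> ha hb hc; have := eP (x - vec3 a b c).
  have F u : (x - vec3 a b c) 0 u = x 0 u - vec3 a b c 0 u.
    by rewrite mxE; congr (_ + _); rewrite mxE.
  have E u : x 0 u - (x - vec3 a b c) 0 u = vec3 a b c 0 u by rewrite F subKr.
  rewrite reeveP !F !vec3E hi hj hz; apply; apply: forall_ord3; rewrite E vec3E; lra.
have n0 : `|0 : R| <= e / 2 by rewrite normr0 ltW.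
have ne : `|e / 2| <= e / 2 by rewrite gtr0_norm.
(* Moving the point by e / 2 along a suitable axis towards each facet makes the four inequalities
   strict. *)
have [h1 _ _ _] := near 0 0 (e / 2) n0 n0 ne.
have [_ h2 _ _] := near (e / 2) 0 0 ne n0 n0.
have [_ _ h3 _] := near 0 (e / 2) 0 n0 ne n0.
have nN : `|- (e / 2)| <= e / 2 by rewrite normrN.
have [_ _ _ h4] := near (- (e / 2)) 0 0 nN n0 n0.
have {h1}z0 : 0 < z%:~R :> R by lra.
have re := mulr_gt0 r0 e2.
have {h2}zi : z%:~R < r%:R * i%:~R :> R by lra.
have {h3}zj : z%:~R < r%:R * j%:~R :> R by lra.
have {h4}zij : r%:R * (i%:~R + j%:~R) - z%:~R < r%:R :> R by lra.
move: z0 zi zj zij; rewrite (ltr_int _ 0) [r%:R]pmulrn -intrD -!intrM -intrB !ltr_int.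
move=> z0 zi zj zij.
have j1 : 1 <= j by nia.
by nia.
Qed.

End Reeve.

(** * The cluster point 1 *)

Section ClusterPointOne.
Variable R : realType.

Lemma Gamma30_root q (x : R) : (0 < q)%N ->
  root (q%:R *: ('X^3 - 'X) + ('X + 1) ^+ 2) x -> Gamma R 3 0 (x%:C)%C.
Proof.
move=> q0 rx; apply/GammaP; exists (reeve q).
exists (q%:R *: ('X^3 - 'X) + ('X + 1) ^+ 2); split.
- exact: reeve_polytope.
- exact: reeve_counts.
have := rx; rewrite -(fmorph_root (real_complex R)) !rmorphD /= rmorphXn /= map_polyZ /=.
by rewrite rmorph_nat !rmorphD /= rmorphN /= rmorph1 map_polyXn map_polyX.
Qed.

Lemma cluster_point1 n : (3 <= n)%N -> cluster_point (Gamma R n 0) 1.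
Proof.
move=> n3; apply: (cluster_point_sub (Gamma0_mono n3)); apply: cluster_point_lim => e e0.
pose d := Num.min (e / 2) (1 / 2).
have d0 : 0 < d by rewrite lt_min !divr_gt0.
have d1 : d <= 1 / 2 by rewrite ge_min lexx orbT.
have de : d < e.
  have : d <= e / 2 by rewrite ge_min lexx.
  by move: e0; move: d {d0 d1} => d; lra.
clearbody d.
(* With q d >= 8 and d <= 1/2, the cubic term at 1 - d is at most -4, while the square (2 - d)^2 is
   at most 4. *)
have [q q0 qd] : exists2 q : nat, (0 < q)%N & 8 <= q%:R * d.
  exists (Num.bound (8 / d)).+1 => //.
  have h : 0 <= 8 / d by rewrite divr_ge0// ltW.
  rewrite -ler_pdivrMr// ltW// (lt_trans (archi_boundP h))//.
  by rewrite ltr_nat.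
pose p : {poly R} := q%:R *: ('X^3 - 'X) + ('X + 1) ^+ 2.
have pE x : p.[x] = q%:R * (x ^+ 3 - x) + (x + 1) ^+ 2 by rewrite !hornerE.
have p1 : p.[1] = 4 by rewrite pE; ring.
have d1' : 1 - d <= 1 by rewrite lerBlDr lerDl ltW.
have pd : p.[1 - d] <= 0 <= p.[1].
  rewrite p1 pE ler0n andbT.
  have -> : q%:R * ((1 - d) ^+ 3 - (1 - d)) = - (q%:R * d * (1 - d) * (2 - d)) by ring.
  have h1 : 1 / 2 <= 1 - d by lra.
  have h2 : 1 <= 2 - d by lra.
  move: (q%:R * d) qd => t qd.
  have h3 : 4 <= t * (1 - d) by nra.
  by move: (t * (1 - d)) h3 => u h3; nra.
have [x /andP[x1 x2] rx] := poly_ivt d1' pd.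
have xn1 : x != 1.
  by apply/eqP => x1E; move: rx; rewrite x1E rootE p1 pnatr_eq0.
exists (x%:C)%C; first split.
- exact: Gamma30_root rx.
- by rewrite -(rmorph1 (real_complex R)) (inj_eq (@complexI R)).
rewrite -(rmorph1 (real_complex R)) -rmorphB /= normc_def /= expr0n addr0 sqrtr_sqr ltcR.
by rewrite distrC ger0_norm ?subr_ge0//; lra.
Qed.

End ClusterPointOne.

(** * Simultaneous approximation and recurrence *)

Section DiophantineApproximation.
Variable R : realType.

(** Pigeonhole: the fractional parts of j [b] for 0 <= j <= Q^m fall into Q^m cells of side 1 / Q;
    two multiples in the same cell are subtracted. *)
Lemma dirichlet_simultaneous Q m (b : 'I_m -> R) : (0 < Q)%N ->
  exists (j : nat) (N : 'I_m -> int),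
    [/\ (0 < j)%N, (j <= Q ^ m)%N & forall i, `|j%:R * b i - (N i)%:~R| < Q%:R^-1].
Proof.
case: Q => // Q _; have Q0 : 0 < Q.+1%:R :> R by [].
pose fr (x : R) := x - (Num.floor x)%:~R.
have fr0 x : 0 <= fr x by rewrite subr_ge0 Num.Theory.floor_le.
have fr1 x : fr x < 1.
  by rewrite ltrBlDl; have := floorD1_gt x; rewrite intrD.
pose cell (x : R) := Num.floor (Q.+1%:R * fr x).
have cell_lt x : (`|cell x| < Q.+1)%N.
  have c0 : 0 <= cell x by rewrite floor_ge0 mulr_ge0.
  have : cell x < Q.+1 by rewrite floor_lt_int -[ltRHS]mulr1 ltr_pM2l.
  by lia.
have cell_close x y : cell x = cell y -> `|fr x - fr y| < Q.+1%:R^-1.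
  move=> cxy; rewrite -(ltr_pM2l Q0) mulfV ?gt_eqF// -{1}(gtr0_norm Q0) -normrM mulrBr.
  have := Num.Theory.floor_le (Q.+1%:R * fr x); have := floorD1_gt (Q.+1%:R * fr x).
  have := Num.Theory.floor_le (Q.+1%:R * fr y); have := floorD1_gt (Q.+1%:R * fr y).
  rewrite -/(cell x) -/(cell y) cxy !intrD.
  by move: (Q.+1%:R * fr x) (Q.+1%:R * fr y) (cell y)%:~R => s t c *; rewrite ltr_norml; lra.
pose f (j : 'I_(Q.+1 ^ m).+1) : {ffun 'I_m -> 'I_Q.+1} :=
  [ffun i => Ordinal (cell_lt (j%:R * b i))].
have /injectivePn[j1 [j2 j12 fj]] : ~~ injectiveb f.
  apply/injectiveP => /leq_card; rewrite card_ffun !card_ord.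
  by rewrite ltnn.
wlog lt12 : j1 j2 j12 fj / (j1 < j2)%N.
  move=> H; have [/H|/H|/val_inj e] := ltngtP j1 j2; [exact| |by rewrite e eqxx in j12].
  by apply=> //; rewrite eq_sym.
exists (j2 - j1)%N, (fun i => Num.floor (j2%:R * b i) - Num.floor (j1%:R * b i)); split.
- by rewrite subn_gt0.
- by rewrite (leq_trans (leq_subr _ _))// -ltnS.
move=> i; have cc : cell (j2%:R * b i) = cell (j1%:R * b i).
  have /ffunP/(_ i) := fj; rewrite !ffunE => -[].
  have c0 x : 0 <= cell x by rewrite floor_ge0 mulr_ge0.
  by have := c0 (j2%:R * b i); have := c0 (j1%:R * b i); lia.
have := cell_close _ _ cc; rewrite /fr natrB ?(ltnW lt12)// intrB.
by congr (`|_| < _); ring.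
Qed.

(* An integer relation making [w = \sum_i b i *: v i] recur: moving along
   [j * b - N] keeps the coefficients of a convex combination nonnegative for
   [2 * l] steps, and scales up the coefficient of index [i0]. *)
Definition recurs l m (b : 'I_m -> R) (i0 : 'I_m) : Prop :=
  exists (j : nat) (N : 'I_m -> int),
    [/\ (0 < j)%N, \sum_i N i = j%:Z, N i0 = 0 &
        forall i, 0 <= b i + (2 * l)%:R * (j%:R * b i - (N i)%:~R)].

(** Dirichlet's theorem is applied with the coefficients below [T'] replaced by 0, which forces
    [N i = 0] there; the others are at least [T] and absorb the approximation errors. *)
Lemma recurs_gap K l (T : R) : 0 < T -> exists2 T' : R, 0 < T' &
  forall m (b : 'I_m -> R), (m <= K)%N -> (forall i, 0 <= b i) -> \sum_i b i = 1 ->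
    (forall i, b i < T' \/ T <= b i) -> forall i, b i < T' -> recurs l b i.
Proof.
move=> T0; have h : 0 <= (2 * l)%:R / T by rewrite divr_ge0// ltW.
(* Q > 2 l / T keeps the coefficients that are at least T nonnegative for 2 l steps; Q > K makes the
   total error m / Q less than 1, so that the integers [N i] sum to j exactly. *)
pose Q := (Num.bound ((2 * l)%:R / T) + K).+1.
have Q0 : 0 < Q%:R :> R by [].
have QT : (2 * l)%:R * Q%:R^-1 <= T.
  rewrite ler_pdivrMr// mulrC -ler_pdivrMr// ltW// (lt_trans (archi_boundP h))//.
  by rewrite ltr_nat /Q ltnS leq_addr.
have J0 : 0 < (Q ^ K)%:R :> R by rewrite ltr0n expn_gt0.
(* Since j <= Q^K, a coefficient below this threshold has [j * b i] at most 1 / Q, so 0 approximates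
   it as well as Dirichlet's theorem does the others. *)
exists (Q%:R * (Q ^ K)%:R)^-1; first by rewrite invr_gt0 mulr_gt0.
set T' := _^-1 => m b mK b0 b1 gap i0 bi0.
have [|j [N [j0 jQ jN]]] := @dirichlet_simultaneous Q m (fun i => if b i < T' then 0 else b i).
  by [].
have N0 i : b i < T' -> N i = 0.
  move=> bi; have := jN i; rewrite bi mulr0 sub0r normrN => hN.
  have : `|(N i)%:~R| < 1 :> R.
    by rewrite (lt_le_trans hN)// invf_le1// ler1n.
  rewrite -intr_norm -[1]/(1%:~R) ltr_int; lia.
have dist i : `|j%:R * b i - (N i)%:~R| <= Q%:R^-1.
  have := jN i; case: ifP => [bi _|_ /ltW//].
  rewrite (N0 _ bi) subr0 ger0_norm ?mulr_ge0//.
  have : j%:R * b i <= (Q ^ K)%:R * T'.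
    apply: ler_pM => //; last exact: ltW.
    by rewrite ler_nat (leq_trans jQ)// leq_pexp2l.
  by rewrite /T' invfM mulrCA mulfV ?mulr1// gt_eqF.
exists j, N; split => //; last first.
- move=> i; have := dist i; rewrite ler_norml => /andP[d1 d2].
  have [bi|bi] := gap i.
    by rewrite N0// subr0 addr_ge0// !mulr_ge0.
  have l0 : 0 <= (2 * l)%:R :> R by [].
  have := ler_wpM2l l0 d1; rewrite mulrN; lra.
- exact: N0.
have : `|(\sum_i N i - j%:Z)%:~R| < 1 :> R.
  have jE : j%:R = \sum_i j%:R * b i by rewrite -mulr_sumr b1 mulr1.
  rewrite intrB raddf_sum /= -pmulrn jE -sumrB.
  apply: le_lt_trans (ler_norm_sum _ _ _) _.
  rewrite (eq_bigr (fun i => `|j%:R * b i - (N i)%:~R|)) => [|i _]; last by rewrite distrC.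
  apply: le_lt_trans (ler_sum _ (fun i _ => dist i)) _.
  rewrite sumr_const card_ord -[_ *+ m]mulr_natl ltr_pdivrMr// mul1r ltr_nat.
  by rewrite /Q ltnS (leq_trans mK)// leq_addl.
rewrite -intr_norm -[1]/(1%:~R) ltr_int; lia.
Qed.

(** Induction on a bound q for the number of coefficients below a threshold T. Either none lies in
    [T', T) and [recurs_gap] applies, or fewer lie below min(T, T'). At the start T = 1 and q =
    K. *)
Lemma recurs_small K l : exists2 c : R, 0 < c &
  forall m (b : 'I_m -> R) i0, (m <= K)%N -> (forall i, 0 <= b i) -> \sum_i b i = 1 ->
    b i0 < c -> recurs l b i0.
Proof.
have step q : forall T : R, 0 < T -> exists2 c : R, 0 < c &
    forall m (b : 'I_m -> R) i0, (m <= K)%N -> (forall i, 0 <= b i) -> \sum_i b i = 1 ->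
    (#|[pred i | (b i < T)%R]| <= q)%N -> b i0 < c -> recurs l b i0.
  elim: q => [|q IH] T T0.
    exists T => // m b i0 _ _ _; rewrite leqn0 => /eqP /card0_eq /(_ i0).
    by rewrite inE => ->.
  have [T' T'0 gapT] := recurs_gap K l T0.
  have T''0 : 0 < Num.min T T' by rewrite lt_min T0.
  have [c c0 hc] := IH _ T''0.
  exists (Num.min c T'); first by rewrite lt_min c0.
  move=> m b i0 mK b0 b1 cardT; rewrite lt_min => /andP[bc bT'].
  have [gap|/existsNP[i /not_orP[/negP biT' /negP]]] :=
      pselect (forall i, b i < T' \/ T <= b i).
    exact: gapT.
  rewrite -ltNge => biT.
  apply: hc => //; rewrite -ltnS (leq_trans _ cardT)//; apply: proper_card.
  apply/properP; split.
    by apply/fintype.subsetP => i'; rewrite !inE lt_min => /andP[].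
  by exists i; rewrite inE// lt_min (negbTE biT') andbF.
have [c c0 hc] := step K 1 ltr01; exists c => // m b i0 mK b0 b1.
by apply: hc => //; rewrite (leq_trans (max_card _))// card_ord.
Qed.

End DiophantineApproximation.

(** * Bounded asymmetry about interior lattice points *)

Section Asymmetry.
Variables (R : realType) (n : nat).
Implicit Types (A P : set 'rV[R]_n) (w v x y : 'rV[R]_n).

Lemma integer_lattice_lincomb m (N : 'I_m -> int) (V : 'I_m -> 'rV[R]_n) :
  (forall i, integer_lattice (V i)) ->
  integer_lattice (\sum_i (N i)%:~R *: V i).
Proof.
move=> VZ i; rewrite summxE rpred_sum// => j _.
by rewrite mxE rpredM ?intr_int//; exact: VZ.
Qed.

Lemma integer_latticeD x y : integer_lattice x -> integer_lattice y -> integer_lattice (x + y).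
Proof. by move=> xZ yZ i; rewrite mxE rpredD. Qed.

Lemma integer_latticeZ (z : int) x : integer_lattice x -> integer_lattice (z%:~R *: x).
Proof. by move=> xZ i; rewrite mxE rpredM ?intr_int. Qed.

(* The points [w + t d], [0 <= t <= l], are interior lattice points, so they
   cannot be distinct. *)
Lemma recurrence_trivial A l m (V : 'I_m -> 'rV[R]_n) (b : 'I_m -> R) (j : nat)
    (N : 'I_m -> int) :
  A `<=` @integer_lattice R n ->
  (convex_hull A)° `&` @integer_lattice R n #= `I_l ->
  (convex_hull A)° (\sum_i b i *: V i) -> integer_lattice (\sum_i b i *: V i) ->
  (forall i, A (V i)) -> (forall i, 0 <= b i) -> \sum_i b i = 1 ->
  \sum_i N i = j%:Z ->
  (forall i, 0 <= b i + (2 * l)%:R * (j%:R * b i - (N i)%:~R)) ->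
  \sum_i (j%:R * b i - (N i)%:~R) *: V i = 0.
Proof.
move=> AZ cardP; set w := \sum_i b i *: V i => wP wZ AV b0 b1 sN bN.
set D := \sum_i _ *: V i; apply/eqP/negPn/negP => D0.
have DE : D = j%:~R *: w + (-1)%:~R *: (\sum_i (N i)%:~R *: V i).
  rewrite mulrN1z scaleN1r /w scaler_sumr -sumrB.
  by apply: eq_bigr => i _; rewrite scalerBl scalerA.
have DZ : integer_lattice D.
  rewrite DE; apply: integer_latticeD; apply: integer_latticeZ => //.
  by apply: integer_lattice_lincomb => i; exact/AZ.
pose f (t : 'I_l.+1) := w + t%:~R *: D.
have fI : injective f.
  move=> s t /addrI /eqP; rewrite -subr_eq0 -scalerBl scaler_eq0 (negbTE D0) orbF.
  by rewrite subr_eq0 eqr_int => /eqP[] /val_inj.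
suff /inj_leq_card : forall t, ((convex_hull A)° `&` @integer_lattice R n) (f t).
  by move=> /(_ _ cardP fI); rewrite card_ord ltnn.
move=> t; split; last by apply: integer_latticeD => //; exact: integer_latticeZ.
(* The midpoint of the interior point w and the combination reached after 2 t steps is interior;
   this is why [recurs] allows 2 l steps. *)
have -> : f t = 2^-1 *: w + 2^-1 *: (\sum_i (b i + (2 * t)%:R * (j%:R * b i - (N i)%:~R)) *: V i).
  under eq_bigr do rewrite scalerDl -scalerA.
  rewrite big_split /= -/w -scaler_sumr -/D scalerDr addrA -scalerDl scalerA natrM.
  rewrite mulrA mulVf ?mul1r ?pnatr_eq0// /f; congr (_ + _).
  by rewrite (_ : 2^-1 + 2^-1 = 1) ?scale1r//; field.
have h0 : 0 < 2^-1 :> R by rewrite invr_gt0.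
apply: (interior_cone_over (b := 2^-1)) => //.
- exact: convex_hull_convex.
- by field.
apply: cone_over_mem; first exact: ltW.
apply: convex_combination_in.
- exact: convex_hull_convex.
- move=> i; have := bN i; set d := j%:R * b i - _ => bd.
  have [d0|d0] := leP 0 d; first by rewrite addr_ge0// mulr_ge0.
  apply: (le_trans bd); rewrite lerD2l; apply: ler_wnM2r; first exact: ltW.
  by rewrite ler_nat leq_mul2l -ltnS ltn_ord orbT.
- by move=> i; exact: sub_convex_hull.
- rewrite big_split /= b1 -mulr_sumr sumrB -mulr_sumr b1 mulr1 -raddf_sum sN.
  by rewrite /= -pmulrn subrr mulr0 addr0.
Qed.

Lemma asymmetry l : exists2 c : R, 0 < c & forall A w,
  A `<=` @integer_lattice R n ->
  (convex_hull A)° `&` @integer_lattice R n #= `I_l ->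
  (convex_hull A)° w -> integer_lattice w ->
  forall x, convex_hull A x -> convex_hull A (w - c *: (x - w)).
Proof.
have [c0 c00 hc0] := recurs_small R n.+2 l.
(* The minimum with 1 makes a < c leave a positive weight 1 - a to the other points. *)
pose c := Num.min c0 1; have cp : 0 < c by rewrite lt_min c00 /=.
exists c => // A w AZ cardP wP wZ; set P := convex_hull A in cardP wP *.
have cP : @convex_set R 'rV[R]_n P by exact: convex_hull_convex.
apply: (@convex_hull_sub _ _ _ [set x | P (w - c *: (x - w))]).
  apply/convex_setE => x y s t s0 t0 st Px Py /=.
  have -> : w - c *: (s *: x + t *: y - w) = s *: (w - c *: (x - w)) + t *: (w - c *: (y - w)).
    rewrite -[w in LHS]scale1r -st; apply/rowP => i; rewrite !mxE; ring.
  by move/convex_setE : cP; apply.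
move=> v Av /=; have Pv : P v by exact: sub_convex_hull.
have l0 : (0 < l)%N.
  rewrite -[l]/(l) -(card_ord 1); apply: (inj_leq_card (f := fun=> w) cardP) => //.
  by move=> i j _; rewrite !ord1.
(* The weights that v can have in a convex representation of w. The chosen a exceeds half their
   supremum, because the recurrence will at least double it. *)
pose L := [set a : R | 0 <= a <= 1 /\ cone_over P (1 - a) (w - a *: v)].
have [a [[/andP[a0 a1] La] amax]] : exists a, L a /\ forall a', L a' -> a' < 2 * a.
  (* A point of [P] slightly beyond w, away from v, shows that [L] has a positive element. *)
  have [t t0 Pt] := interior_step (2 *: w - v) wP.
  have t10 : 0 < 1 + t by rewrite ltr_pwDl// ltW.
  have Lt : L (t / (1 + t)).
    split.
      by rewrite ler_pdivrMr// mul1r lerDr ler01 andbT divr_ge0// ltW.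
    have -> : 1 - t / (1 + t) = (1 + t)^-1 by field; rewrite gt_eqF.
    right; rewrite invr_gt0 invrK; split => //.
    have -> // : (1 + t) *: (w - (t / (1 + t)) *: v) = w + t *: (2 *: w - v - w).
    rewrite scalerBr scalerA mulrCA mulfV ?gt_eqF// mulr1.
    by apply/rowP => i; rewrite !mxE; ring.
  have supL : has_sup L.
    by split; [exists (t / (1 + t))|exists 1 => a [/andP[]]].
  have sup0 : 0 < sup L.
    by rewrite (lt_le_trans _ (ub_le_sup supL.2 Lt))// divr_gt0.
  have sup20 : 0 < sup L / 2 by rewrite divr_gt0.
  have [a La alt] := sup_adherent sup20 supL.
  exists a; split => // a' /(ub_le_sup supL.2) a'le; lra.
have ap : 0 < a.
  by have := amax a (conj _ La); rewrite a0 a1 => /(_ isT); lra.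
suff ca : c <= a.
  apply/cone_over1.
  have -> : w - c *: (v - w) = (a - c * (1 - a)) *: v + (1 + c) *: (w - a *: v).
    by apply/rowP => i; rewrite !mxE; ring.
  have E : (a - c * (1 - a)) + (1 + c) * (1 - a) = 1 by ring.
  rewrite -[X in cone_over _ X _]E.
  apply: cone_overD => //.
    by apply: cone_over_mem => //; nra.
  by apply: cone_over_scale => //; rewrite addr_ge0// ltW.
rewrite leNgt; apply/negP => ac.
have [ac0 ac1] : a < c0 /\ a < 1 by move: ac; rewrite lt_min => /andP[].
have a1p : 0 < 1 - a by rewrite subr_gt0.
case: La => [[/eqP]|[_ hy]]; first by rewrite gt_eqF.
(* Carathéodory's bound, together with v, limits the number of coefficients to n + 2, which makes
   [c0] uniform. *)
have [m mn [v' [mu [Av' mu0 mu1 yE]]]] := caratheodory hy.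
pose b (i : 'I_m.+1) := if unlift ord0 i is Some k then (1 - a) * mu k else a.
pose V (i : 'I_m.+1) := if unlift ord0 i is Some k then v' k else v.
have bl k : b (lift ord0 k) = (1 - a) * mu k by rewrite /b liftK.
have b00 : b ord0 = a by rewrite /b unlift_none.
have Vl k : V (lift ord0 k) = v' k by rewrite /V liftK.
have V00 : V ord0 = v by rewrite /V unlift_none.
have b0 i : 0 <= b i.
  by rewrite /b; case: unlift => // k; rewrite mulr_ge0// ltW.
have AV i : A (V i) by rewrite /V; case: unlift.
have b1 : \sum_i b i = 1.
  rewrite big_ord_recl b00; under eq_bigr do rewrite bl.
  by rewrite -mulr_sumr mu1 mulr1 addrC subrK.
have wE : w = \sum_i b i *: V i.
  rewrite big_ord_recl b00 V00; under eq_bigr do rewrite bl Vl -scalerA.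
  rewrite -scaler_sumr -yE scalerA mulfV ?gt_eqF// scale1r.
  by rewrite addrC subrK.
have bc : b ord0 < c0 by rewrite b00.
have [j [N [j0 sN N0 bN]]] := hc0 m.+1 b ord0 mn b0 b1 bc.
have := recurrence_trivial (V := V) (b := b) AZ cardP.
rewrite -wE => /(_ j N wP wZ AV b0 b1 sN bN) D0.
(* The coefficients after 2 l steps. The translation vector is 0, so they represent w again, but the
   weight of v is now a (1 + 2 l j) >= 2 a, against the choice of a. *)
pose e i := b i + (2 * l)%:R * (j%:R * b i - (N i)%:~R).
have e1 : \sum_i e i = 1.
  rewrite big_split /= b1 -mulr_sumr sumrB -mulr_sumr b1 mulr1 -raddf_sum sN.
  by rewrite /= -pmulrn subrr mulr0 addr0.
have e00 : e ord0 = a * (1 + (2 * l * j)%:R).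
  by rewrite /e N0 b00 subr0 natrM; ring.
have eE : w = \sum_i e i *: V i.
  under eq_bigr do rewrite /e scalerDl -scalerA.
  by rewrite big_split /= -wE -scaler_sumr D0 scaler0 addr0.
have es : \sum_(k < m) e (lift ord0 k) = 1 - e ord0.
  by rewrite -e1 big_ord_recl addrAC subrr add0r.
have : L (e ord0).
  split.
    by rewrite bN /= -subr_ge0 -es sumr_ge0// => k _; exact: bN.
  rewrite {1}eE big_ord_recl V00 addrAC subrr add0r -es.
  apply: cone_over_sum => // [k _|k _]; first exact: bN.
  by rewrite Vl; exact: sub_convex_hull.
move/amax; rewrite e00 mulrC ltr_pM2r// => /lt_geF.
have : (1 <= 2 * l * j)%N by rewrite !muln_gt0 l0.
by rewrite -(ler_nat R) => h; rewrite -[2]/(1 + 1) lerD2l h.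
Qed.

(** The point is a convex combination of w, x and the reflected point w - c (y - w) with weights 1 -
    t (1 + 1/c), t and t/c, and the weight of the interior point w is positive. *)
Lemma interior_difference P w (c t : R) x y : @convex_set R 'rV[R]_n P -> P° w ->
  0 < c -> P x -> P (w - c *: (y - w)) -> 0 <= t -> t * (1 + c^-1) < 1 ->
  P° (w + t *: (x - y)).
Proof.
move=> cP wP c0 Px Py t0 tc.
have -> : w + t *: (x - y) =
    (1 - t * (1 + c^-1)) *: w + (t *: x + (t / c) *: (w - c *: (y - w))).
  by apply/rowP => i; rewrite !mxE; field; rewrite gt_eqF.
apply: (interior_cone_over (b := t + t / c)) => //; first by rewrite subr_gt0.
  by ring.
apply: cone_overD => //; apply: cone_over_mem => //.
by rewrite divr_ge0// ltW.
Qed.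

End Asymmetry.

(** * Lattice points congruent modulo M *)

Section ResidueClasses.
Variables (R : realType) (n : nat).
Implicit Types (P : set 'rV[R]_n) (x y : 'rV[R]_n).

Lemma pigeonhole_card (I J : finType) q (g : I -> J) : (#|J| * q < #|I|)%N ->
  exists r, (q < #|[pred i | g i == r]|)%N.
Proof.
move=> h; apply: contrapT => /forallNP nq.
move: h; rewrite ltnNge => /negP; apply.
rewrite -sum1_card (partition_big g predT)//= -sum_nat_const.
apply: leq_sum => r _; rewrite sum1_card leqNgt.
exact/negP/(nq r).
Qed.

Lemma residue_class (q M m : nat) (f : 'I_m -> 'rV[R]_n) : (0 < M)%N ->
  (forall i, integer_lattice (f i)) -> (M ^ n * q < m)%N ->
  exists h : 'I_q.+1 -> 'I_m, injective h /\
    forall i j, integer_lattice (M%:R^-1 *: (f (h i) - f (h j))).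
Proof.
case: M => // M _ fZ qm.
have MR : M.+1%:R != 0 :> R by rewrite pnatr_eq0.
have md (z : int) : (0 <= (z %% M.+1)%Z) && ((z %% M.+1)%Z < M.+1%:Z).
  by rewrite modz_ge0 //= ltz_pmod.
pose g (i : 'I_m) : {ffun 'I_n -> 'I_M.+1} :=
  [ffun k => inord `|(Num.floor (f i ord0 k) %% M.+1)%Z|%N].
have [r hr] : exists r, (q < #|[pred i | g i == r]|)%N.
  by apply: pigeonhole_card; rewrite card_ffun !card_ord.
exists (fun i => enum_val (widen_ord hr i)); split.
  by move=> i j /enum_val_inj /(congr1 val) /= /val_inj.
have gr i : g (enum_val (widen_ord hr i)) = r.
  by have := enum_valP (widen_ord hr i); rewrite inE => /eqP.
move=> i j k; have := etrans (gr i) (esym (gr j)) => /ffunP/(_ k); rewrite !ffunE.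
move: (enum_val _) (enum_val _) => i' j'.
rewrite !mxE; have := fZ i' k; have := fZ j' k.
move: (f i' 0 k) (f j' 0 k) => x y /intrP[a ->] /intrP[b ->].
rewrite !intrKfloor => /(congr1 (@nat_of_ord _)); rewrite !inordK; last 2 first.
- by have := md b; lia.
- by have := md a; lia.
move=> ab.
have abM : (a %% M.+1)%Z = (b %% M.+1)%Z by have := md a; have := md b; lia.
apply/intrP; exists ((a %/ M.+1)%Z - (b %/ M.+1)%Z).
have -> : a%:~R - b%:~R = ((a %/ M.+1)%Z - (b %/ M.+1)%Z)%:~R * M.+1%:R :> R.
  rewrite -intrB {1}(divz_eq a M.+1) {1}(divz_eq b M.+1) abM opprD addrACA subrr addr0.
  by rewrite -mulrBl intrM.
by rewrite mulrC mulfK.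
Qed.

End ResidueClasses.

(** * Bounds on the number of lattice points of dilates *)

Section LatticePointBounds.
Variables (R : realType) (n : nat).
Implicit Types (P : set 'rV[R]_n) (w x y z : 'rV[R]_n).

(** Otherwise l + 1 of the points agree modulo k D. Their differences with one of them, divided by k
    D, are 1 / D times differences of points of [P]; added to w they give l + 1 interior lattice
    points. *)
Lemma lattice_points_bound P l w (c : R) (D k m : nat) :
  @convex_set R 'rV[R]_n P -> P° `&` @integer_lattice R n #= `I_l ->
  P° w -> integer_lattice w -> 0 < c -> (forall x, P x -> P (w - c *: (x - w))) ->
  1 + c^-1 < D%:R -> (0 < k)%N ->
  dilate k P `&` @integer_lattice R n #= `I_m -> (m <= (k * D) ^ n * l)%N.
Proof.
move=> cP Pl wP wZ c0 hc cD k0 /card_range[f fI fE]; rewrite leqNgt; apply/negP => hm.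
have D0 : 0 < D%:R :> R by rewrite (lt_trans _ cD)// addr_gt0// invr_gt0.
have kD0 : (0 < k * D)%N by rewrite muln_gt0 k0 -(ltr0n R).
have fP i : (dilate k P `&` @integer_lattice R n) (f i) by rewrite fE; exists i.
have [h [hI hZ]] := residue_class kD0 (fun i => (fP i).2) hm.
pose g i := w + (k * D)%:R^-1 *: (f (h i) - f (h ord0)).
have gI : injective g.
  move=> i j /addrI /scalerI e; apply/hI/fI/(addIr (- f (h ord0)))/e.
  by rewrite invr_eq0 pnatr_eq0 -lt0n.
suff /inj_leq_card : forall i, (P° `&` @integer_lattice R n) (g i).
  by move=> /(_ _ Pl gI); rewrite card_ord ltnn.
move=> i; split; last by apply: integer_latticeD => //; exact: hZ.
have [[x Px xE] _] := fP (h i); have [[y Py yE] _] := fP (h ord0).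
have -> : g i = w + D%:R^-1 *: (x - y).
  rewrite /g -xE -yE -scalerBr scalerA natrM invfM mulrAC mulVf ?mul1r//.
  by rewrite pnatr_eq0 -lt0n.
apply: (interior_difference (c := c)) => //; first exact: hc.
by rewrite mulrC ltr_pdivrMr// mul1r.
Qed.

(* Strict convexity of the Euclidean norm. *)
Lemma midpoint_max_norm x y z : x + y = 2 *: z ->
  \sum_i x 0 i ^+ 2 <= \sum_i z 0 i ^+ 2 -> \sum_i y 0 i ^+ 2 <= \sum_i z 0 i ^+ 2 ->
  y = z.
Proof.
move=> e hx hy; have xE i : x 0 i = 2 * z 0 i - y 0 i.
  have /rowP/(_ i) := e; rewrite !mxE => <-.
  by rewrite addrK.
have : \sum_i (y 0 i - z 0 i) ^+ 2 <= 0.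
  have -> : \sum_i (y 0 i - z 0 i) ^+ 2 = 2^-1 * (\sum_i x 0 i ^+ 2 - \sum_i z 0 i ^+ 2
      + (\sum_i y 0 i ^+ 2 - \sum_i z 0 i ^+ 2)).
    rewrite -!sumrB -big_split /= mulr_sumr; apply: eq_bigr => i _.
    by rewrite xE; field.
  by lra.
move=> le0; apply/rowP => i; apply/eqP; rewrite -subr_eq0 -sqrf_eq0.
have : \sum_i (y 0 i - z 0 i) ^+ 2 == 0.
  by rewrite eq_le le0 sumr_ge0// => j _; exact: sqr_ge0.
rewrite psumr_eq0 => [|j _]; last exact: sqr_ge0.
by move=> /allP/(_ i (mem_index_enum i)).
Qed.

Lemma symmetric_lattice_points_bound P l (k m : nat) :
  symmetric_polytopes_with_interior_points l P -> (0 < k)%N ->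
  dilate k P `&` @integer_lattice R n #= `I_m -> (m <= (2 * k).+1 ^ n * l.+1./2)%N.
Proof.
move=> [[/lattice_polytopeP[s [PE _ [x0 x0P]]] Pl] Ps] k0 /card_range[f fI fE].
have cP : @convex_set R 'rV[R]_n P by rewrite PE; exact: convex_hull_convex.
have PN x : P x -> P (- x) by move=> Px; rewrite Ps; exists x.
have P0 : P° 0.
  rewrite (_ : 0 = 2^-1 *: x0 + 2^-1 *: (- x0)); last by rewrite scalerN subrr.
  apply: (interior_cone_over (b := 2^-1)) => //; first by field.
  apply: cone_over_mem; first by rewrite invr_ge0.
  by apply: PN; exact: interior_subset.
rewrite leqNgt; apply/negP => hm; set q := l.+1./2 in hm.
have fP i : (dilate k P `&` @integer_lattice R n) (f i) by rewrite fE; exists i.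
have [h [hI hZ]] := residue_class (ltn0Sn (2 * k)) (fun i => (fP i).2) hm.
set M : R := (2 * k).+1%:R in hZ.
have M0 : 0 < M by rewrite ltr0n.
have diffP i j : P° (M^-1 *: (f (h i) - f (h j))).
  have [[x Px <-] _] := fP (h i); have [[y Py <-] _] := fP (h j).
  rewrite -scalerBr scalerA -[X in P° X]add0r.
  have M'0 : 0 <= M^-1 * k%:R by rewrite mulr_ge0// invr_ge0 ltW.
  apply: (interior_difference (c := 1)) => //.
    by rewrite scale1r subr0 sub0r; exact: PN.
  rewrite invr1 -mulrA ltr_pdivrMl// mulr1 (_ : k%:R * (1 + 1) = (2 * k)%:R).
    by rewrite ltr_nat.
  by rewrite natrM; ring.
pose S i := \sum_k (f (h i)) 0 k ^+ 2.
have [b _ bmax] := @arg_maxP _ _ _ (ord0 : 'I_q.+1) xpredT S isT.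
(* The left branch includes 0, for i = b. A coincidence between the branches would make the longest
   point [f (h b)] the midpoint of two points that are no longer than it. *)
pose g (u : 'I_q.+1 + 'I_q) := match u with
  | inl i => M^-1 *: (f (h i) - f (h b))
  | inr i => M^-1 *: (f (h b) - f (h (lift b i))) end.
have sc x y : M^-1 *: x = M^-1 *: y -> x = y.
  by apply: scalerI; rewrite invr_eq0 gt_eqF.
have gmix i j : M^-1 *: (f (h i) - f (h b)) = M^-1 *: (f (h b) - f (h (lift b j))) -> False.
  move=> /sc e; have /fI/hI : f (h (lift b j)) = f (h b).
    apply: (@midpoint_max_norm (f (h i))); [|exact: bmax..].
    move/eqP: e; rewrite subr_eq addrAC eq_sym subr_eq => /eqP <-.
    by rewrite scaler_nat mulr2n.
  by move/eqP; rewrite eq_sym (negbTE (neq_lift _ _)).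
have gI : injective g.
  move=> [i|i] [j|j] /=.
  - by move=> /sc/addIr/fI/hI ->.
  - by move/gmix.
  - by move/esym/gmix.
  - by move=> /sc/addrI/oppr_inj/fI/hI/lift_inj ->.
have := inj_leq_card Pl gI; rewrite card_sum !card_ord => le_l.
have : (q.+1 + q <= l)%N.
  apply: le_l => -[i|i] /=; split; [exact: diffP|exact: hZ|exact: diffP|exact: hZ].
(* As q is (l + 1) / 2 rounded down, 2 q + 1 exceeds l for either parity. *)
by rewrite /q; lia.
Qed.

End LatticePointBounds.

(** * Finiteness of the root sets *)

Section Finiteness.
Variable R : realType.
Local Notation C := R[i].

Definition bounded_polys (n b : nat) : set {poly C} := [set G : {poly C} |
  [/\ G != 0, (size G <= n.+1)%N &
      forall k, (0 < k <= n.+1)%N -> exists2 m : nat, (m <= b)%N & G.[k%:R] = m%:R]].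

(** A polynomial of degree at most n is determined by its values at 1, ..., n + 1, each of which has
    b + 1 possibilities. *)
Lemma finite_bounded_polys n b : finite_set (bounded_polys n b).
Proof.
set E := bounded_polys n b.
pose phi (G : {poly C}) : {ffun 'I_n.+1 -> C} := [ffun i : 'I_n.+1 => G.[i.+1%:R]].
have phiI : {in E &, injective phi}.
  move=> G H /set_mem[_ sG _] /set_mem[_ sH _] /ffunP e.
  apply/eqP; rewrite -subr_eq0; apply/eqP/(@roots_geq_poly_eq0 _ _
    [seq (i : 'I_n.+1).+1%:R | i <- enum 'I_n.+1]).
  - apply/allP => _ /mapP[i _ ->]; have := e i; rewrite !ffunE => ei.
    by rewrite rootE hornerD hornerN ei subrr.
  - rewrite map_inj_uniq ?enum_uniq// => i j /eqP.
    by rewrite eqr_nat => /eqP[] /val_inj.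
  - rewrite size_map size_enum_ord (leq_trans (size_polyD _ _))//.
    by rewrite geq_max size_polyN sG.
have : finite_set (phi @` E).
  apply: (@sub_finite_set _ _ (range (fun u : {ffun 'I_n.+1 -> 'I_b.+1} =>
      [ffun i => (u i : nat)%:R] : {ffun 'I_n.+1 -> C}))); last first.
    exact/finite_image/finite_finset.
  move=> _ [G [_ _ hG] <-].
  have /choice[u hu] : forall i : 'I_n.+1, exists m : 'I_b.+1, G.[i.+1%:R] = (m : nat)%:R.
    move=> i; have [|m mb Gm] := hG i.+1; first by rewrite ltn_ord.
    by exists (inord m); rewrite inordK.
  by exists (finfun u) => //; apply/ffunP => i; rewrite !ffunE hu.
by rewrite (eq_finite_set (inj_card_eq phiI)).
Qed.

Lemma finite_roots (G : {poly C}) : G != 0 -> finite_set [set z | root G z].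
Proof.
move=> G0; have [s ->] := closed_field_poly_normal G.
apply: (@sub_finite_set _ _ [set` s]); last exact: finite_seq.
move=> z /=; rewrite rootZ ?lead_coef_eq0//.
by rewrite root_prod_XsubC.
Qed.

Lemma finite_Gamma n l : (1 <= l)%N -> finite_set (Gamma R n l).
Proof.
move=> l0; have [c c0 hc] := asymmetry R n l.
pose D := (Num.bound (1 + c^-1)).+1.
have cD : 1 + c^-1 < D%:R.
  have h : 0 <= 1 + c^-1 by rewrite addr_ge0// invr_ge0 ltW.
  by rewrite (lt_trans (archi_boundP h))// ltr_nat.
(* The bound on the number of lattice points at k = n + 1, the largest argument needed. *)
pose b := ((n.+1 * D) ^ n * l)%N.
have finU : finite_set (\bigcup_(G in bounded_polys n b) [set z : C | root G z]).
  apply: bigcup_finite; first exact: finite_bounded_polys.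
  by move=> G [G0 _ _]; exact: finite_roots.
apply: sub_finite_set finU.
move=> s /GammaP[P [G [[/lattice_polytopeP[t [PE tZ _]] Pl] cG rs]]].
exists G; last exact: rs.
have [u _ uE] := card_range Pl.
have [wP wZ] : (P° `&` @integer_lattice R n) (u (Ordinal l0)).
  by rewrite uE; exists (Ordinal l0).
have cP : @convex_set R 'rV[R]_n P by rewrite PE; exact: convex_hull_convex.
have bnd k m : (0 < k)%N -> dilate k P `&` @integer_lattice R n #= `I_m ->
    (m <= (k * D) ^ n * l)%N.
  apply: (lattice_points_bound cP Pl wP wZ c0 _ cD).
  by rewrite PE; apply: hc => //; rewrite -PE.
split.
(* The value at 1 is positive, since it counts at least an interior lattice point. *)
- apply/eqP => G0; have [m mP Gm] := cG 1%N isT.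
  have : (#|'I_1| <= m)%N.
    apply: (inj_leq_card (f := fun=> u (Ordinal l0)) mP) => [i j _|_]; first by rewrite !ord1.
    by split => //; exists (u (Ordinal l0)); [exact: interior_subset|rewrite scale1r].
  move/eqP: Gm; rewrite G0 hornerC eq_sym pnatr_eq0 card_ord => /eqP ->.
  by [].
(* The bound (k D)^n l is a polynomial of degree n in k, which limits the degree of [G]. *)
- apply: (@size_le_of_bound _ _ ((D ^ n * l)%:R *: 'X^n)).
    by rewrite (leq_trans (size_scale_leq _ _))// size_polyXn.
  move=> k k0; have [m mP ->] := cG k k0; rewrite ler0n /=.
  by rewrite hornerZ hornerXn -natrX -natrM ler_nat mulnAC -expnMn [(D * k)%N]mulnC; exact: bnd.
- move=> k /andP[k0 kn]; have [m mP Gm] := cG k k0; exists m => //.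
  rewrite (leq_trans (bnd k m k0 mP))// leq_mul2r /b; apply/orP; right.
  by case: (n) kn => [//|n' kn]; rewrite leq_exp2r// leq_mul2r kn orbT.
Qed.

End Finiteness.

(** * The inequality for symmetric polytopes *)

Section SymmetricBound.
Variable R : realType.

Lemma symmetric_bound n l (P : set 'rV[R]_n) (gamma : 'I_n -> R[i]) : (1 <= n)%N ->
  symmetric_polytopes_with_interior_points l P -> ehrhart_factorization P gamma ->
  2^-1 * n.-root (2 / l.+1%:R) <= n.-root (\prod_(i < n) gamma i).
Proof.
move=> n0 Psym [g0 GE].
have [sG Gn] := prod_linear (fun i => (gamma i)^-1); rewrite -GE in sG Gn.
have prodV : \prod_i (gamma i)^-1 = (\prod_i gamma i)^-1 by rewrite prodfV.
have prod0 : \prod_i gamma i != 0 by apply/prodf_neq0.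
(* The default [1] is excluded: its coefficient of index n >= 1 is 0, whereas here it is the inverse
   of the product of the [gamma i]. *)
have cG : counts_lattice_points P (ehrhart P).
  apply: ehrhart_counts => P1; move/eqP: Gn.
  by rewrite P1 prodV coefC gtn_eqF// eq_sym invr_eq0 (negbTE prod0).
have Gk k : (0 < k)%N -> 0 <= (ehrhart P).[k%:R] <= ((2 * k).+1 ^ n * l.+1./2)%:R.
  move=> k0; have [m mP ->] := cG k k0.
  by rewrite ler0n ler_nat (symmetric_lattice_points_bound Psym k0 mP).
have Gn0 : 0 <= (ehrhart P)`_n by apply: coef_ge0 => // k /Gk/andP[].
have [sQ Qn] := prod_linear (fun=> 2 : R[i]) (n := n); rewrite !prodr_const card_ord in sQ Qn.
(* The counting bound compares two polynomials at all positive integers, hence their coefficients of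
   index n. *)
have : 0 <= (l.+1./2%:R *: (1 + 2 *: 'X) ^+ n - ehrhart P)`_n.
  apply: coef_ge0.
    rewrite (leq_trans (size_polyD _ _))// geq_max size_polyN sG andbT.
    by rewrite (leq_trans (size_scale_leq _ _)).
  move=> k /Gk /andP[_]; rewrite hornerD hornerN subr_ge0; congr (_ <= _).
  rewrite !(hornerE, horner_exp) natrM natrX -natr1 natrM mulrC.
  by congr (_ * _ ^+ _); rewrite addrC.
rewrite coefB coefZ Qn subr_ge0 => bound.
have G0 : 0 < (ehrhart P)`_n by rewrite lt_neqAle Gn0 andbT eq_sym Gn prodV invr_eq0.
have gE : \prod_i gamma i = ((ehrhart P)`_n)^-1 by rewrite Gn prodV invrK.
have x0 : 0 < 2^-1 ^+ n * (2 / l.+1%:R) :> R[i].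
  by rewrite mulr_gt0 ?exprn_gt0 ?divr_gt0 ?invr_gt0 ?ltr0n.
rewrite half_rootC// gE ler_rootC ?nnegrE ?invr_ge0 ?(ltW x0)//.
rewrite -[leLHS]invrK lef_pV2 ?posrE ?invr_gt0//.
apply: (le_trans bound); rewrite invfM exprVn invrK mulrC invf_div ler_wpM2l ?exprn_ge0//.
by rewrite ler_pdivlMr ?ltr0n// -natrM ler_nat; lia.
Qed.

End SymmetricBound.

(* In part (iii), <= on R[i] compares numbers with equal imaginary parts, and
   n.-root of a nonnegative real is its nonnegative real n-th root. *)
Theorem theorem1p7 (R : realType) :
  (* (i) *)
  ((forall n : nat, (2 <= n)%N ->
      Gamma R n.-1 0 `<=` Gamma R n 0 /\ cluster_point (Gamma R n 0) 0)
   /\ (forall n : nat, (3 <= n)%N -> cluster_point (Gamma R n 0) 1)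
   /\ (forall n : nat, (2 <= n)%N -> infinite_set (Gamma R n 0)))
  /\
  (* (ii) *)
  (forall l : nat, (1 <= l)%N ->
     (forall n : nat, (2 <= n)%N -> Gamma R n.-1 l `<=` Gamma R n l)
     /\ (forall n : nat, (1 <= n)%N -> finite_set (Gamma R n l)))
  /\
  (* (iii) *)
  ((forall n l : nat, (1 <= n)%N ->
      forall P : set 'rV[R]_n, symmetric_polytopes_with_interior_points l P ->
      forall gamma : 'I_n -> R[i], ehrhart_factorization P gamma ->
        2^-1 * n.-root (2 / l.+1%:R) <= n.-root (\prod_(i < n) gamma i))
   /\
   (forall n l : nat, (1 <= n)%N -> odd l ->
      exists P : set 'rV[R]_n, symmetric_polytopes_with_interior_points l P /\
      exists gamma : 'I_n -> R[i], ehrhart_factorization P gamma /\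
        2^-1 * n.-root (2 / l.+1%:R) = n.-root (\prod_(i < n) gamma i))).
Proof.
split; [split; [|split]|split].
- move=> n n2; split; last exact: cluster_point0.
  exact/Gamma0_mono/leq_pred.
- by move=> n; exact: cluster_point1.
- move=> n n2; apply: cluster_point_infinite (cluster_point0 n2).
- move=> l l1; split=> n n1; last exact: finite_Gamma.
  case: n n1 => // n _ /=; rewrite -[l in X in _ `<=` X]mul1n.
  exact: (@Gamma_segment_prod R n l 2).
- split=> [n l n1 P Ps gamma gE|n l]; first exact: symmetric_bound gE.
  exact: tight_example.
Qed.
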